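(* (i) Let $\gamma:[0,\ell_\gamma]\to\mathbb R$ be a normalised profile function such that $S^2_\gamma$ is symmetric with respect to the equator, i.e. $\gamma(t)=\gamma(\ell_\gamma-t)$, and such that the Gaussian curvature $K$ increases from the poles to the equator, i.e. $K$ is increasing as a function of $t\in[0,\ell_\gamma/2]$. Then $m_\gamma\le1$. Therefore $\mathrm{Con}_\gamma=[0,+\infty)$. (ii) For every $C>0$ there exists a normalised profile function $\gamma$ such that $S^2_\gamma$ is convex (i.e. $K\ge0$) and $m_\gamma>C$.
   Context: A normalised profile function is a smooth $\gamma:[0,\ell_\gamma]\to\mathbb R$ such that: $\gamma(0)=\gamma(\ell_\gamma)=0$ and $\gamma>0$ on $(0,\ell_\gamma)$; $\dot\gamma(0)=1$, $\dot\gamma(\ell_\gamma)=-1$ and $|\dot\gamma|<1$ on $(0,\ell_\gamma)$; all even derivatives of $\gamma$ vanish at $0$ and $\ell_\gamma$; $\int_0^{\ell_\gamma}\gamma\,dt=2$. The surface of revolution $S^2_\gamma$ is the quotient of $[0,\ell_\gamma]\times\mathbb R/2\pi\mathbb Z$ (coordinates $(t,\theta)$) collapsing each boundary circle to a point (a pole), with metric $g_\gamma=dt^2+\gamma(t)^2d\theta^2$ (smooth at the poles, total area $4\pi$), area form $\mu_\gamma=\gamma\,dt\wedge d\theta$ and Gaussian curvature $K=-\ddot\gamma/\gamma$. The norm of a one-form $\beta$ is $\|\beta\|=\sup_x|\beta_x|_{g_\gamma}$, and $$m_\gamma:=\inf\{\|\beta\|\ :\ \beta\in\Omega^1(S^2_\gamma),\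 d\beta=(1-K)\mu_\gamma\}.$$ On $\pi:TS^2_\gamma\to S^2_\gamma$ put $\lambda_{(x,v)}(\xi)=g_\gamma(v,d\pi\,\xi)$, $\omega=d\lambda-\pi^*\mu_\gamma$, $E(x,v)=\frac12|v|^2$, $\Sigma_m=\{E=m^2/2\}$ and define $X$ by $\imath_X\omega=-dE$. $\mathrm{Con}_\gamma$ is the set consisting of $0$ (by convention) and all $m>0$ such that $\Sigma_m$ is of positive contact type, i.e. $\omega|_{\Sigma_m}$ has a primitive $\alpha$ with $\alpha(X)>0$ everywhere on $\Sigma_m$. *)

(* Defs.v *)
From Stdlib Require Import Reals Lra.
From Coquelicot Require Import Coquelicot.
Open Scope R_scope.

(* Calculus on an open subset U of a (finite-dimensional) normed space V. *)
Section Forms.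
Context {V : NormedModule R_AbsRing}.

Definition dirD (f : V -> R) (v p : V) : R :=
  Derive (fun s => f (plus p (scal s v))) 0.

(* In finite dimension this is the usual class C^n. *)
Fixpoint Ck (n : nat) (U : V -> Prop) (f : V -> R) : Prop :=
  (forall p, U p -> continuous f p) /\
  match n with
  | O => True
  | S k => forall v,
      (forall p, U p -> ex_derive (fun s => f (plus p (scal s v))) 0) /\
      Ck k U (dirD f v)
  end.

Definition smooth_on (U : V -> Prop) (f : V -> R) : Prop := forall n, Ck n U f.

Definition one_form_on (U : V -> Prop) (a : V -> V -> R) : Prop :=
  (forall p, U p -> is_linear (V := R_NormedModule) (a p)) /\
  (forall v, smooth_on U (fun p => a p v)).

Definition ext_d (a : V -> V -> R) (p u v : V) : R :=
  dirD (fun q => a q v) u p - dirD (fun q => a q u) v p.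

Definition level_tangent (F : V -> R) (q xi : V) : Prop := dirD F xi q = 0.

(* On a regular level set S = {F = c} in U, a family [a] of functionals on the
   tangent spaces T_q S is a smooth one-form when it is locally the restriction
   of smooth one-forms b on open subsets W of V; its differential is then the
   restriction of db to TS, whatever the choice of b.  The predicate says that
   [a] is such a form and that its differential is the restriction to S of the
   two-form [w]. *)
Definition level_primitive (U : V -> Prop) (F : V -> R) (c : R)
    (w : V -> V -> V -> R) (a : V -> V -> R) : Prop :=
  forall q, U q -> F q = c ->
  exists (W : V -> Prop) (b : V -> V -> R),
    open W /\ W q /\ (forall q', W q' -> U q') /\ one_form_on W b /\
    forall q', W q' -> F q' = c ->
      (forall xi, level_tangent F q' xi -> a q' xi = b q' xi) /\
      (forall xi eta, level_tangent F q' xi -> level_tangent F q' eta ->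
        ext_d b q' xi eta = w q' xi eta).

End Forms.

(* The plane R^2 and its tangent bundle R^2 x R^2, with points (p, v). *)
Definition E2 : NormedModule R_AbsRing :=
  prod_NormedModule R_AbsRing R_NormedModule R_NormedModule.
Definition TE2 : NormedModule R_AbsRing := prod_NormedModule R_AbsRing E2 E2.

Definition velocity (c : R -> E2) : E2 :=
  (Derive (fun s => fst (c s)) 0, Derive (fun s => snd (c s)) 0).

(* A smooth function on [0, l] is represented by one of its smooth extensions
   to R (one always exists); everything below depends only on the values on
   [0, l]. *)
Record normalised_profile (l : R) (gam : R -> R) : Prop := {
  np_length : 0 < l;
  np_smooth : forall n t, ex_derive_n gam n t;
  np_left : gam 0 = 0;
  np_right : gam l = 0;
  np_pos : forall t, 0 < t < l -> 0 < gam t;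
  np_dleft : Derive gam 0 = 1;
  np_dright : Derive gam l = -1;
  np_dlt1 : forall t, 0 < t < l -> Rabs (Derive gam t) < 1;
  np_even : forall k, Derive_n gam (2 * k) 0 = 0 /\ Derive_n gam (2 * k) l = 0;
  np_area : is_RInt gam 0 l 2
}.

(* Gaussian curvature at latitude t.  At the poles -gam''/gam is 0/0 and K is
   its limit, computed by l'Hopital's rule. *)
Definition curvature (gam : R -> R) (t : R) : R :=
  if Req_EM_T (gam t) 0 then - Derive_n gam 3 t / Derive gam t
  else - Derive_n gam 2 t / gam t.

Section Surface.
Variables (l : R) (gam : R -> R).

Definition radius (p : E2) : R := sqrt (fst p ^ 2 + snd p ^ 2).

(* The sphere of revolution is covered by two oriented charts onto the open
   disc of radius l, indexed by bool: p = t (cos theta, sin theta) around the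
   pole t = 0 for [true], and p = (l - t) (cos theta, - sin theta) around the
   pole t = l for [false].  The transition map [trans] is given by the same
   formula in both directions, on 0 < radius p < l. *)
Definition disc (p : E2) : Prop := radius p < l.
Definition overlap (p : E2) : Prop := 0 < radius p < l.
Definition trans (p : E2) : E2 :=
  ((l - radius p) / radius p * fst p, - ((l - radius p) / radius p * snd p)).
Definition d_trans (p v : E2) : E2 :=
  velocity (fun s => trans (plus p (scal s v))).

Definition lat (b : bool) (p : E2) : R := if b then radius p else l - radius p.

(* The forms dt and d theta for p <> 0 in the chart [true]; in the chart
   [false] these are - dt and - d theta; the signs cancel in [metric] and
   [area]. *)
Definition dt (p v : E2) : R := (fst p * fst v + snd p * snd v) / radius p.
Definition dtheta (p v : E2) : R :=
  (fst p * snd v - snd p * fst v) / radius p ^ 2.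

(* dt^2 + gam(t)^2 dtheta^2 and gam dt /\ dtheta, extended by continuity to
   the pole. *)
Definition metric (b : bool) (p u v : E2) : R :=
  if Req_EM_T (radius p) 0 then fst u * fst v + snd u * snd v
  else dt p u * dt p v + gam (lat b p) ^ 2 * (dtheta p u * dtheta p v).
Definition area (b : bool) (p u v : E2) : R :=
  if Req_EM_T (radius p) 0 then fst u * snd v - snd u * fst v
  else gam (lat b p) * (dt p u * dtheta p v - dt p v * dtheta p u).

Definition sphere_one_form (beta : bool -> E2 -> E2 -> R) : Prop :=
  (forall b, one_form_on disc (beta b)) /\
  (forall b p v, overlap p ->
     beta (negb b) (trans p) (d_trans p v) = beta b p v).

Definition covector_norm (b : bool) (p : E2) (f : E2 -> R) : R :=
  real (Lub_Rbar (fun y => exists v, metric b p v v <= 1 /\ y = Rabs (f v))).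

Definition form_norm (beta : bool -> E2 -> E2 -> R) : Rbar :=
  Lub_Rbar (fun y => exists b p, disc p /\ y = covector_norm b p (beta b p)).

Definition m_gamma : Rbar :=
  Glb_Rbar (fun y => exists beta,
    sphere_one_form beta /\
    (forall b p u v, disc p ->
       ext_d (beta b) p u v = (1 - curvature gam (lat b p)) * area b p u v) /\
    form_norm beta = Finite y).

(* The tangent bundle of the surface, in the two induced charts. *)
Definition Tdisc (q : TE2) : Prop := disc (fst q).
Definition Ttrans (q : TE2) : TE2 := (trans (fst q), d_trans (fst q) (snd q)).
Definition d_Ttrans (q xi : TE2) : TE2 :=
  (velocity (fun s => fst (Ttrans (plus q (scal s xi)))),
   velocity (fun s => snd (Ttrans (plus q (scal s xi))))).

Definition lambda (b : bool) (q xi : TE2) : R :=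
  metric b (fst q) (snd q) (fst xi).
Definition omega (b : bool) (q xi eta : TE2) : R :=
  ext_d (lambda b) q xi eta - area b (fst q) (fst xi) (fst eta).
Definition energy (b : bool) (q : TE2) : R :=
  / 2 * metric b (fst q) (snd q) (snd q).

(* [omega] is nondegenerate, so this determines X. *)
Definition hamiltonian_field (X : bool -> TE2 -> TE2) : Prop :=
  forall b q eta, Tdisc q -> omega b q (X b q) eta = - dirD (energy b) eta q.

(* [alpha b] is a one-form on the part of Sigma_m over the chart b, and the
   second condition says that the two forms agree on the overlap. *)
Definition primitive_on_level (m : R) (alpha : bool -> TE2 -> TE2 -> R) : Prop :=
  (forall b, level_primitive Tdisc (energy b) (m ^ 2 / 2) (omega b) (alpha b)) /\
  (forall b q xi, overlap (fst q) -> energy b q = m ^ 2 / 2 ->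
     level_tangent (energy b) q xi ->
     alpha (negb b) (Ttrans q) (d_Ttrans q xi) = alpha b q xi).

Definition positive_contact_type (m : R) : Prop :=
  exists X alpha,
    hamiltonian_field X /\ primitive_on_level m alpha /\
    forall b q, Tdisc q -> energy b q = m ^ 2 / 2 -> 0 < alpha b q (X b q).

Definition Con (m : R) : Prop := m = 0 \/ (0 < m /\ positive_contact_type m).

End Surface.

(* Main.v *)
From Pilot Require Import Defs.
From Stdlib Require Import Reals Lra Lia FunctionalExtensionality.
From Coquelicot Require Import Coquelicot.
(* Coquelicot has its own [disc]. *)
Import Pilot.Defs.
Open Scope R_scope.

(* Let Gamma(t) = int_0^t gam - 1 and B = Gamma + gam'.  Then B dtheta is a
   primitive of (1 - K) mu of norm sup |B| / gam, and by Stokes on the parallels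
   every other primitive has at least this norm.

   (i) K increases and |gam'| < 1, so K >= 0 and, on [0, l/2], 0 <= B <= gam'
   (as Gamma <= 0) while B' = (1 - K) gam <= gam; hence B B' <= gam gam' and
   B^2 <= gam^2.  If phi is the angle of v in the frame (d_t, d_theta / gam), the
   form lambda + dphi - Gamma dtheta is a primitive of omega on Sigma_m whose
   value on X is m^2 + 1 - B dtheta(v) >= m^2 + 1 - m > 0.  In each chart it is
   written in an orthonormal frame that is smooth at the pole; smoothness there
   rests on Hadamard division of functions with vanishing odd (or even)
   derivatives at 0.

   (ii) If gam' falls from 1 to about 1/2 within a distance of order 1/N from
   the pole, then there B is close to -1/2 and gam is of order 1/N. *)

(** The obstacle is the poles: polar coordinates degenerate there, while every form must be smooth
    in a Cartesian chart. So each polar quantity is replaced by a quotient that is smooth across the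
    pole: with g the profile measured from the pole of the chart, g = t + t^3 k, int_0^t g = t^2 S
    and g' - 1 = t^2 s. A form f(t) dtheta then becomes f / t^2 times [cross]. The constant -1 in
    Gamma is half the total integral: with it B vanishes at both poles, and Gamma changes sign when
    the charts are exchanged, exactly as dtheta does, so that the local forms glue. Symmetry also
    gives B = 0 at the equator. As B' = (1 - K) gam and K increases, B can only rise first and fall
    afterwards on a half, whence B >= 0. The angle phi has no global formula on the bundle; dphi is
    replaced by (w1 dw2 - w2 dw1) / m^2, with w the components of v in the frame, which is closed
    only after restriction to vectors tangent to the level. *)

Definition is_dirD {V : NormedModule R_AbsRing} (f : V -> R) (v p : V) (d : R) :=
  is_derive (fun s : R => f (plus p (scal s v))) 0 d.

Definition smooth {V : NormedModule R_AbsRing} (f : V -> R) : Prop :=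
  smooth_on (fun _ => True) f.

(** * Directional derivatives and smooth functions on a normed space *)

Section Smooth.
Context {V : NormedModule R_AbsRing}.
Implicit Types f g : V -> R.

Lemma dirD_unique f v p d : is_dirD f v p d -> dirD f v p = d.
Proof. exact (is_derive_unique _ _ _). Qed.

Lemma at_line_0 (p v : V) : plus p (scal (0:R) v) = p.
Proof. change (plus p (scal zero v) = p). now rewrite scal_zero_l, plus_zero_r. Qed.

Lemma continuous_line (p v : V) s : continuous (fun s : R => plus p (scal s v)) s.
Proof.
  apply (continuous_plus (K := R_AbsRing) (fun _ => p) (fun s : R => scal s v)).
  - apply continuous_const.
  - apply (continuous_scal_l (K := R_AbsRing) (fun s : R => s) v), continuous_id.
Qed.

Lemma is_dirD_const c v p : is_dirD (fun _ : V => c) v p 0.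
Proof. exact (is_derive_const (V := R_NormedModule) c 0). Qed.

Lemma is_dirD_plus f g v p df dg :
  is_dirD f v p df -> is_dirD g v p dg ->
  is_dirD (fun q => f q + g q) v p (df + dg).
Proof. exact (is_derive_plus (V := R_NormedModule) _ _ _ _ _). Qed.

Lemma is_dirD_mult f g v p df dg :
  is_dirD f v p df -> is_dirD g v p dg ->
  is_dirD (fun q => f q * g q) v p (df * g p + f p * dg).
Proof.
  intros Hf Hg. unfold is_dirD in *.
  evar_last.
  - apply (is_derive_mult (fun s : R => f (plus p (scal s v)))); eauto.
    intros; apply Rmult_comm.
  - now rewrite !at_line_0.
Qed.

Lemma is_dirD_comp (h : R -> R) f v p df dh :
  is_derive h (f p) dh -> is_dirD f v p df ->
  is_dirD (fun q => h (f q)) v p (dh * df).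
Proof.
  intros Hh Hf. unfold is_dirD in *.
  rewrite Rmult_comm.
  apply (is_derive_comp (V := R_NormedModule) h (fun s : R => f (plus p (scal s v))));
    now rewrite ?at_line_0.
Qed.

Lemma Ck_pred U n f : Ck (S n) U f -> Ck n U f.
Proof.
  revert f; induction n as [|n IH]; intros f [Hc Hd]; split; auto.
  intros v; destruct (Hd v); auto.
Qed.

Lemma Ck_sub (U W : V -> Prop) n f :
  (forall p, W p -> U p) -> Ck n U f -> Ck n W f.
Proof.
  intros HW; revert f; induction n as [|n IH]; intros f [Hc Hd]; split; auto.
  intros v; destruct (Hd v); auto.
Qed.

Lemma smooth_restrict (U : V -> Prop) f : smooth f -> smooth_on U f.
Proof. intros H n; apply (Ck_sub (fun _ => True)); auto. Qed.

Lemma smooth_on_continuous U f p : smooth_on U f -> U p -> continuous f p.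
Proof. intros H Hp; exact (proj1 (H 0%nat) p Hp). Qed.

Lemma smooth_on_is_dirD U f v p : smooth_on U f -> U p -> is_dirD f v p (dirD f v p).
Proof. intros H Hp; apply Derive_correct, (proj1 (proj2 (H 1%nat) v)), Hp. Qed.

Lemma smooth_on_dirD U f v : smooth_on U f -> smooth_on U (dirD f v).
Proof. intros H n; apply (proj2 (H (S n)) v). Qed.

(** Replaces the derivative in the recursion of [Ck] by an explicit formula, so that each closure
    property reduces to one computed derivative. Working on the whole space lets the two be
    identified as functions. *)
Lemma Ck_S n f (df : V -> V -> R) :
  (forall p, continuous f p) ->
  (forall v p, is_dirD f v p (df v p)) ->
  (forall v, Ck n (fun _ => True) (df v)) ->
  Ck (S n) (fun _ => True) f.
Proof.
  intros Hc Hd Hk; split; [easy|]; intros v; split.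
  - intros p _; eexists; apply Hd.
  - replace (dirD f v) with (df v); [easy|].
    apply functional_extensionality; intros p; symmetry; apply dirD_unique, Hd.
Qed.

Lemma Ck_const n c : Ck n (fun _ : V => True) (fun _ => c).
Proof.
  revert c; induction n as [|n IH]; intros c.
  - split; [intros; apply continuous_const|easy].
  - apply (Ck_S _ _ (fun _ _ => 0)); auto.
    + intros; apply continuous_const.
    + intros; apply is_dirD_const.
Qed.

Lemma Ck_plus n f g :
  Ck n (fun _ => True) f -> Ck n (fun _ => True) g ->
  Ck n (fun _ => True) (fun p => f p + g p).
Proof.
  revert f g; induction n as [|n IH]; intros f g [Hf Hf'] [Hg Hg'].
  - split; [|easy]; intros p _.
    apply (continuous_plus (V := R_NormedModule)); auto.
  - apply (Ck_S _ _ (fun v p => dirD f v p + dirD g v p)).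
    + intros p; apply (continuous_plus (V := R_NormedModule)); auto.
    + intros v p; apply is_dirD_plus; apply Derive_correct;
        [apply (Hf' v)|apply (Hg' v)]; easy.
    + intros v; apply IH; [apply (Hf' v)|apply (Hg' v)].
Qed.

Lemma Ck_mult n f g :
  Ck n (fun _ => True) f -> Ck n (fun _ => True) g ->
  Ck n (fun _ => True) (fun p => f p * g p).
Proof.
  revert f g; induction n as [|n IH]; intros f g Hf Hg.
  - split; [|easy]; intros p _.
    apply (continuous_mult (K := R_AbsRing)); [apply Hf|apply Hg]; easy.
  - pose proof (Ck_pred _ _ _ Hf). pose proof (Ck_pred _ _ _ Hg).
    destruct Hf as [Hf Hf'], Hg as [Hg Hg'].
    apply (Ck_S _ _ (fun v p => dirD f v p * g p + f p * dirD g v p)).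
    + intros p; apply (continuous_mult (K := R_AbsRing)); auto.
    + intros v p; apply is_dirD_mult; apply Derive_correct;
        [apply (Hf' v)|apply (Hg' v)]; easy.
    + intros v; apply Ck_plus; apply IH; auto; [apply (Hf' v)|apply (Hg' v)].
Qed.

Lemma smooth_const c : smooth (fun _ : V => c).
Proof. intros n; apply Ck_const. Qed.

Lemma smooth_plus f g : smooth f -> smooth g -> smooth (fun p => f p + g p).
Proof. intros Hf Hg n; apply Ck_plus; auto. Qed.

Lemma smooth_mult f g : smooth f -> smooth g -> smooth (fun p => f p * g p).
Proof. intros Hf Hg n; apply Ck_mult; auto. Qed.

Lemma smooth_opp f : smooth f -> smooth (fun p => - f p).
Proof.
  intros Hf. replace (fun p => - f p) with (fun p => -1 * f p).
  - apply smooth_mult; [apply smooth_const|easy].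
  - apply functional_extensionality; intros; ring.
Qed.

Lemma smooth_minus f g : smooth f -> smooth g -> smooth (fun p => f p - g p).
Proof. intros Hf Hg; apply smooth_plus, smooth_opp; easy. Qed.

Lemma smooth_linear f :
  (forall p, continuous f p) ->
  (forall p v s, f (plus p (scal s v)) = f p + s * f v) -> smooth f.
Proof.
  intros Hc Hl [|n]; [split; auto|].
  apply (Ck_S _ _ (fun v _ => f v)); auto.
  - intros v p; apply (is_derive_ext (fun s => f p + s * f v)).
    + intros; now rewrite Hl.
    + auto_derive; auto; ring.
  - intros; apply Ck_const.
Qed.

End Smooth.

(** The induction is over all smooth h, since the chain rule applies the inductive hypothesis to h',
    here written [dirD h 1]. *)
Lemma Ck_comp (V : NormedModule R_AbsRing) n (h : R -> R) (f : V -> R) :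
  smooth h -> Ck n (fun _ => True) f -> Ck n (fun _ => True) (fun p => h (f p)).
Proof.
  revert h; induction n as [|n IH]; intros h Hh Hf.
  - split; [|easy]; intros p _. apply (continuous_comp f h); [now apply Hf|].
    now apply (smooth_on_continuous (V := R_NormedModule) (fun _ => True) h).
  - pose proof (Ck_pred _ _ _ Hf). destruct Hf as [Hf Hf'].
    assert (Hh' : smooth (dirD h 1)) by now apply smooth_on_dirD.
    apply (Ck_S _ _ (fun v p => dirD (V := R_NormedModule) h 1 (f p) * dirD f v p)).
    + intros p; apply (continuous_comp f h); [now apply Hf|].
      now apply (smooth_on_continuous (V := R_NormedModule) (fun _ => True) h).
    + intros v p; apply is_dirD_comp.
      * pose proof (smooth_on_is_dirD _ h 1 (f p) Hh I) as D.
        unfold is_dirD in D.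
        (* Recentres at t = f p: the directional derivative of h along 1 is taken at parameter 0,
           the ordinary one at f p. *)
        apply (is_derive_ext (fun t => h (plus (f p) (scal (t - f p) 1)))).
        { intros t; f_equal; change (f p + (t - f p) * 1 = t); ring. }
        evar_last.
        { apply (is_derive_comp (V := R_NormedModule)
            (fun s : R => h (plus (f p) (scal s 1))) (fun t => t - f p)).
          - replace (f p - f p) with 0 by ring; exact D.
          - auto_derive; auto. }
        { change (1 * dirD h 1 (f p) = dirD h 1 (f p)); ring. }
      * apply Derive_correct, (Hf' v); easy.
    + intros v; apply Ck_mult; auto. apply (Hf' v).
Qed.

Lemma smooth_comp (V : NormedModule R_AbsRing) (h : R -> R) (f : V -> R) : smooth h -> smooth f -> smooth (fun p => h (f p)).
Proof. intros Hh Hf n; apply Ck_comp; auto. Qed.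

Lemma smooth_fst_comp (V W : NormedModule R_AbsRing) (f : V -> R) :
  smooth f -> smooth (V := prod_NormedModule R_AbsRing V W) (fun q => f (fst q)).
Proof.
  intros Hf n; specialize (Hf n); revert f Hf.
  induction n as [|n IH]; intros f [Hc Hd].
  - split; [|easy]; intros [p w] _.
    apply (continuous_comp fst f); [apply continuous_fst|now apply Hc].
  - apply (Ck_S _ _ (fun v q => dirD f (fst v) (fst q))).
    + intros [p w]. apply (continuous_comp fst f); [apply continuous_fst|now apply Hc].
    + intros v q; apply Derive_correct, (Hd (fst v)); easy.
    + intros v; apply (IH (dirD f (fst v))), Hd.
Qed.

Lemma smooth_snd_comp (V W : NormedModule R_AbsRing) (f : W -> R) :
  smooth f -> smooth (V := prod_NormedModule R_AbsRing V W) (fun q => f (snd q)).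
Proof.
  intros Hf n; specialize (Hf n); revert f Hf.
  induction n as [|n IH]; intros f [Hc Hd].
  - split; [|easy]; intros [p w] _.
    apply (continuous_comp snd f); [apply continuous_snd|now apply Hc].
  - apply (Ck_S _ _ (fun v q => dirD f (snd v) (snd q))).
    + intros [p w]. apply (continuous_comp snd f); [apply continuous_snd|now apply Hc].
    + intros v q; apply Derive_correct, (Hd (snd v)); easy.
    + intros v; apply (IH (dirD f (snd v))), Hd.
Qed.

(** * One real variable *)

Lemma smooth_R_id : smooth (fun t : R => t).
Proof.
  apply smooth_linear; [intros; apply continuous_id|reflexivity].
Qed.

Lemma is_derive_dirD (f : R -> R) t d v :
  is_derive f t d -> is_dirD f v t (v * d).
Proof.
  intros Hf; unfold is_dirD.
  apply (is_derive_comp (V := R_NormedModule) f (fun s => plus t (scal s v))).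
  - change (is_derive f (t + 0 * v) d). now rewrite Rmult_0_l, Rplus_0_r.
  - change (is_derive (fun s => t + s * v) 0 v). auto_derive; auto; ring.
Qed.

Lemma dirD_1 (f : R -> R) t : dirD f 1 t = Derive f t.
Proof.
  unfold dirD, Derive; f_equal; apply Lim_ext; intros h.
  unfold plus, scal; simpl; unfold mult; simpl.
  now rewrite Rmult_0_l, Rplus_0_r, Rmult_1_r, Rplus_0_l.
Qed.

Lemma Ck_R_S n (f df : R -> R) :
  (forall t, is_derive f t (df t)) -> Ck n (fun _ : R => True) df ->
  Ck (S n) (fun _ : R => True) f.
Proof.
  intros Hd Hk; apply (Ck_S (V := R_NormedModule) _ _ (fun v t => v * df t)).
  - intros t; apply (ex_derive_continuous (V := R_NormedModule)); eexists; apply Hd.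
  - intros v t; now apply is_derive_dirD.
  - intros v; apply Ck_mult; [apply Ck_const|easy].
Qed.

Lemma smooth_R_intro (f df : R -> R) :
  (forall t, is_derive f t (df t)) -> smooth df -> smooth f.
Proof.
  intros Hd Hs n; apply Ck_pred, (Ck_R_S n f df); auto.
Qed.

Lemma smooth_is_derive (f : R -> R) t : smooth f -> is_derive f t (Derive f t).
Proof.
  intros Hf; apply Derive_correct.
  pose proof (smooth_on_is_dirD _ f 1 t Hf I) as D'.
  exists (dirD f 1 t).
  apply (is_derive_ext (fun u => f (plus t (scal (u - t) 1)))).
  - intros u; f_equal; change (t + (u - t) * 1 = u); ring.
  - replace (dirD f 1 t) with (scal 1 (dirD f 1 t)) by exact (scal_one (K := R_AbsRing) (V := R_NormedModule) _).
    apply (is_derive_comp (V := R_NormedModule) (fun s : R => f (plus t (scal s 1))) (fun u => u - t)).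
    + replace (t - t) with 0 by ring; exact D'.
    + auto_derive; auto.
Qed.

Lemma smooth_Derive (f : R -> R) : smooth f -> smooth (Derive f).
Proof.
  intros Hf; replace (Derive f) with (dirD f 1).
  - now apply smooth_on_dirD.
  - apply functional_extensionality; intros; apply dirD_1.
Qed.

Lemma smooth_Derive_n (f : R -> R) n : smooth f -> smooth (Derive_n f n).
Proof. intros Hf; induction n; simpl; auto. now apply smooth_Derive. Qed.

Lemma smooth_ex_derive_n (f : R -> R) n t : smooth f -> ex_derive_n f n t.
Proof.
  intros Hf; destruct n as [|n]; simpl; [easy|].
  eexists; now apply smooth_is_derive, smooth_Derive_n.
Qed.

Lemma smooth_of_ex_derive_n (f : R -> R) :
  (forall n t, ex_derive_n f n t) -> smooth f.
Proof.
  intros Hf n; assert (G : forall k, Ck n (fun _ => True) (Derive_n f k)); [|exact (G 0%nat)].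
  induction n as [|n IH]; intros k.
  - split; [|easy]; intros t _.
    apply (ex_derive_continuous (V := R_NormedModule)), (Hf (S k)).
  - apply (Ck_R_S n _ (Derive_n f (S k))); auto.
    intros t; apply Derive_correct, (Hf (S k)).
Qed.

Lemma smooth_continuous (f : R -> R) t : smooth f -> continuous f t.
Proof. intros Hf; now apply (smooth_on_continuous (V := R_NormedModule) (fun _ => True) f). Qed.

Lemma smooth_pow n : smooth (fun t : R => t ^ n).
Proof.
  induction n; simpl; [apply smooth_const|].
  apply smooth_mult; [apply smooth_R_id|easy].
Qed.

Lemma smooth_primitive (f : R -> R) : smooth f -> smooth (RInt f 0) /\
  forall t, is_derive (RInt f 0) t (f t).
Proof.
  intros Hf.
  assert (H : forall t, is_derive (RInt f 0) t (f t)).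
  { intros t; apply (is_derive_RInt f _ 0).
    - apply filter_forall; intros u; apply (RInt_correct (V := R_CompleteNormedModule)).
      apply (ex_RInt_continuous (V := R_CompleteNormedModule)); intros; now apply smooth_continuous.
    - now apply smooth_continuous. }
  split; [|easy]; now apply (smooth_R_intro _ f).
Qed.

(** * Hadamard's lemma and functions of the radius *)

(** Hadamard's quotient is q(t) = int_0^1 g'(tu) du. Its k-th derivative is [J k], the integral of
    u^k g^(k+1)(tu), so one differentiation under the integral sign covers all orders. *)
Lemma smooth_divisible (g : R -> R) :
  smooth g -> g 0 = 0 -> exists q, smooth q /\ forall t, g t = t * q t.
Proof.
  intros Hg H0.
  set (J := fun k t => RInt (fun u => u ^ k * Derive_n g (S k) (t * u)) 0 1).
  assert (C : forall k t u, continuous (fun u => u ^ k * Derive_n g (S k) (t * u)) u).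
  { intros k t u; apply (smooth_continuous (fun u => u ^ k * Derive_n g (S k) (t * u))).
    apply smooth_mult; [apply smooth_pow|].
    apply smooth_comp; [now apply smooth_Derive_n|].
    apply smooth_mult; [apply smooth_const|apply smooth_R_id]. }
  assert (D : forall k t u, is_derive (fun t => u ^ k * Derive_n g (S k) (t * u)) t
                (u ^ S k * Derive_n g (S (S k)) (t * u))).
  { intros k t u.
    assert (Hd := smooth_is_derive _ (t * u) (smooth_Derive_n g (S k) Hg)).
    evar_last.
    - apply (is_derive_scal (fun t => Derive_n g (S k) (t * u)) t (u ^ k)).
      apply (is_derive_comp (V := R_NormedModule) (Derive_n g (S k)) (fun t => t * u)).
      + exact Hd.
      + auto_derive; [easy|reflexivity].
    - change (u ^ k * ((1 * u) * Derive_n g (S (S k)) (t * u))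
        = u * u ^ k * Derive_n g (S (S k)) (t * u)); ring. }
  assert (DJ : forall k t, is_derive (J k) t (J (S k) t)).
  { intros k t. unfold J at 2.
    rewrite (RInt_ext _ (fun u => Derive (fun t => u ^ k * Derive_n g (S k) (t * u)) t)).
    2:{ intros u _; symmetry; apply is_derive_unique, D. }
    apply (is_derive_RInt_param (fun t u => u ^ k * Derive_n g (S k) (t * u))).
    - apply filter_forall; intros s u _; eexists; apply D.
    - intros u _. apply (continuity_2d_pt_ext (fun t u => u ^ S k * Derive_n g (S (S k)) (t * u))).
      { intros s v; symmetry; apply is_derive_unique, D. }
      apply continuity_2d_pt_mult.
      + apply (continuity_1d_2d_pt_comp (fun u => u ^ S k) (fun _ v => v)).
        * apply continuity_pt_filterlim, (smooth_continuous _ _ (smooth_pow (S k))).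
        * apply continuity_2d_pt_id2.
      + apply (continuity_1d_2d_pt_comp _ (fun u v => u * v)).
        * apply continuity_pt_filterlim, (smooth_continuous _ _ (smooth_Derive_n g _ Hg)).
        * apply continuity_2d_pt_mult; [apply continuity_2d_pt_id1|apply continuity_2d_pt_id2].
    - apply filter_forall; intros s.
      apply (ex_RInt_continuous (V := R_CompleteNormedModule)); intros; apply C. }
  exists (J 0%nat); split.
  - intros n; cut (forall k, Ck n (fun _ => True) (J k)); [auto|].
    induction n as [|n IH]; intros k.
    + split; [|easy]; intros t _.
      apply (ex_derive_continuous (V := R_NormedModule)); eexists; apply DJ.
    + apply (Ck_R_S n _ (J (S k))); auto.
  - intros t; unfold J.
    assert (E : is_RInt (fun u => scal t (1 * Derive g (t * u))) 0 1 (g t - g 0)).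
    { replace (g t - g 0) with (minus (g (t * 1)) (g (t * 0)))
        by (now rewrite Rmult_0_r, Rmult_1_r).
      apply (is_RInt_derive (V := R_CompleteNormedModule) (fun u => g (t * u))).
      - intros u _. evar_last.
        + apply (is_derive_comp (V := R_NormedModule) g (fun u => t * u)).
          * now apply smooth_is_derive.
          * auto_derive; [easy|reflexivity].
        + change (t * 1 * Derive g (t * u) = t * (1 * Derive g (t * u))); ring.
      - intros u _; apply (continuous_scal_r (K := R_AbsRing) (V := R_NormedModule) t (fun u => 1 * Derive g (t * u))), (C 0%nat). }
    rewrite H0, Rminus_0_r in E. rewrite <- (is_RInt_unique _ _ _ _ E).
    rewrite (RInt_scal (V := R_CompleteNormedModule)); [reflexivity|].
    apply (ex_RInt_continuous (V := R_CompleteNormedModule)); intros; apply (C 0%nat).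
Qed.

(** At t = 0 only the term (n + 1) q^(n)(0) survives: dividing by t lowers the order of each
    derivative at 0 by one, and so exchanges even and odd jets. *)
Lemma Derive_n_id_mult (q : R -> R) n t :
  smooth q ->
  Derive_n (fun t => t * q t) (S n) t = t * Derive_n q (S n) t + INR (S n) * Derive_n q n t.
Proof.
  intros Hq; revert t; induction n as [|n IH]; intros t.
  - simpl. apply is_derive_unique.
    evar_last; [apply (is_derive_mult (fun t : R => t) q); [auto_derive; easy|now apply smooth_is_derive|]|].
    + intros; apply Rmult_comm.
    + change (1 * q t + t * Derive q t = t * Derive q t + 1 * q t); ring.
  - change (Derive (Derive_n (fun t => t * q t) (S n)) t
      = t * Derive_n q (S (S n)) t + INR (S (S n)) * Derive_n q (S n) t).
    rewrite (Derive_ext _ _ t IH). apply is_derive_unique.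
    evar_last.
    + apply (is_derive_plus (V := R_NormedModule)).
      * apply (is_derive_mult (fun t : R => t) (Derive_n q (S n))).
        -- auto_derive; easy.
        -- now apply smooth_is_derive, smooth_Derive_n.
        -- intros; apply Rmult_comm.
      * apply (is_derive_scal (Derive_n q n)). now apply smooth_is_derive, smooth_Derive_n.
    + rewrite !S_INR.
      change (1 * Derive_n q (S n) t + t * Derive_n q (S (S n)) t + (INR n + 1) * Derive_n q (S n) t
        = t * Derive_n q (S (S n)) t + (INR n + 1 + 1) * Derive_n q (S n) t); ring.
Qed.

(* Parity is imposed on the jet at 0 only, since [f (radius p)] sees only t >= 0. *)
Definition radial (f : R -> R) : Prop :=
  smooth f /\ forall k, Derive_n f (2 * k + 1) 0 = 0.

Lemma radial_quot (F q : R -> R) :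
  smooth q -> (forall t, F t = t * q t) ->
  (forall k, Derive_n F (2 * k) 0 = 0) -> radial q.
Proof.
  intros Hq E H; split; [easy|]; intros k.
  specialize (H (S k)).
  rewrite (Derive_n_ext _ _ _ _ E) in H.
  replace (2 * S k)%nat with (S (2 * k + 1)) in H by lia.
  rewrite Derive_n_id_mult, Rmult_0_l, Rplus_0_l in H by easy.
  apply Rmult_integral in H; destruct H as [H|H]; [|easy].
  now apply not_0_INR in H.
Qed.

Lemma odd_quot (F q : R -> R) :
  smooth q -> (forall t, F t = t * q t) ->
  (forall k, Derive_n F (2 * k + 1) 0 = 0) -> forall k, Derive_n q (2 * k) 0 = 0.
Proof.
  intros Hq E H k; specialize (H k).
  rewrite (Derive_n_ext _ _ _ _ E) in H.
  replace (2 * k + 1)%nat with (S (2 * k)) in H by lia.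
  rewrite Derive_n_id_mult, Rmult_0_l, Rplus_0_l in H by easy.
  apply Rmult_integral in H; destruct H as [H|H]; [|easy].
  now apply not_0_INR in H.
Qed.

(** Two divisions by t: the first turns an even jet into an odd one, whose value at 0 vanishes and
    allows the second. *)
Lemma radial_div_sqr (F : R -> R) :
  radial F -> F 0 = 0 -> exists s, radial s /\ forall t, F t = t ^ 2 * s t.
Proof.
  intros [HF HF'] H0.
  destruct (smooth_divisible F HF H0) as [q [Hq E]].
  assert (Hodd := odd_quot F q Hq E HF').
  destruct (smooth_divisible q Hq (Hodd 0%nat)) as [s [Hs E']].
  exists s; split; [now apply (radial_quot q)|].
  intros t; rewrite E, E'; ring.
Qed.

(** The differential of f([radius]) is f'(r) / r times [dot]. As f' / t is again radial, the
    induction in [smooth_radial] never leaves this class. *)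
Lemma radial_Derive (f : R -> R) :
  radial f -> exists f1, radial f1 /\ forall t, is_derive f t (t * f1 t).
Proof.
  intros [Hf Hf'].
  destruct (smooth_divisible (Derive f)) as [f1 [H1 E]].
  - now apply smooth_Derive.
  - apply (Hf' 0%nat).
  - exists f1; split.
    + apply (radial_quot (Derive f)); auto. intros k.
      change (Derive f) with (Derive_n f 1). rewrite Derive_n_comp. apply Hf'.
    + intros t; rewrite <- E; now apply smooth_is_derive.
Qed.

Lemma radial_primitive_derivative (g : R -> R) :
  smooth g -> (forall k, Derive_n g (2 * k) 0 = 0) -> radial (RInt g 0) /\ radial (Derive g).
Proof.
  intros Hg H; destruct (smooth_primitive g Hg) as [Hs Hd]; split; split; auto.
  - intros k; rewrite <- Derive_n_comp, (Derive_n_ext _ g); [apply H|].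
    intros t; now apply is_derive_unique.
  - now apply smooth_Derive.
  - intros k; change (Derive g) with (Derive_n g 1). rewrite Derive_n_comp.
    replace (2 * k + 1 + 1)%nat with (2 * S k)%nat by lia; apply H.
Qed.

(** * The plane and radial functions *)

Definition dot (p u : E2) : R := fst p * fst u + snd p * snd u.
Definition cross (p u : E2) : R := fst p * snd u - snd p * fst u.

Lemma radius_pos p : 0 <= radius p.
Proof. apply sqrt_pos. Qed.

Lemma radius_sqr p : radius p ^ 2 = fst p ^ 2 + snd p ^ 2.
Proof. unfold radius; rewrite pow2_sqrt; [easy|nra]. Qed.

Lemma radius_0 p : radius p = 0 -> fst p = 0 /\ snd p = 0.
Proof. intros H; pose proof (radius_sqr p) as E; rewrite H in E; split; nra. Qed.

Lemma smooth_fst_E2 : smooth (V := E2) fst.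
Proof. apply (smooth_fst_comp R_NormedModule R_NormedModule (fun x => x)), smooth_R_id. Qed.

Lemma smooth_snd_E2 : smooth (V := E2) snd.
Proof. apply (smooth_snd_comp R_NormedModule R_NormedModule (fun x => x)), smooth_R_id. Qed.

Lemma continuous_radius (p : E2) : continuous radius p.
Proof.
  apply (continuous_comp (fun p : E2 => fst p ^ 2 + snd p ^ 2) sqrt).
  - apply (smooth_on_continuous (V := E2) (fun _ => True)); [|easy].
    apply smooth_plus; (apply (smooth_comp E2 (fun x => x ^ 2)); [apply smooth_pow|]);
      [apply smooth_fst_E2|apply smooth_snd_E2].
  - apply continuous_sqrt.
Qed.

Lemma is_dirD_radius (p v : E2) :
  0 < radius p -> is_dirD (V := E2) radius v p (dot p v / radius p).
Proof.
  destruct p as [x y], v as [v1 v2]; intros Hr.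
  change (is_derive (fun s => sqrt ((x + s * v1) ^ 2 + (y + s * v2) ^ 2)) 0
    ((x * v1 + y * v2) / radius (x, y))).
  assert (Hp : 0 < x ^ 2 + y ^ 2).
  { pose proof (radius_sqr (x, y)) as E; simpl fst in E; simpl snd in E. rewrite <- E; nra. }
  auto_derive.
  - rewrite !Rmult_0_l, !Rplus_0_r; lra.
  - unfold radius; simpl fst; simpl snd.
    replace ((x + 0 * v1) * ((x + 0 * v1) * 1) + (y + 0 * v2) * ((y + 0 * v2) * 1))
      with (x ^ 2 + y ^ 2) by ring.
    pose proof (sqrt_lt_R0 _ Hp). field. lra.
Qed.

(** Along a line through the pole the radius is |s| c, which has a corner; f'(0) = 0 removes it. *)
Lemma is_derive_comp_Rabs (f : R -> R) c :
  0 <= c -> is_derive f 0 0 -> is_derive (fun s => f (Rabs s * c)) 0 0.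
Proof.
  intros Hc Hf; apply is_derive_Reals; apply is_derive_Reals in Hf.
  destruct (Req_dec c 0) as [->|Hc0].
  { intros eps He; exists (mkposreal _ He); intros h _ _.
    rewrite !Rmult_0_r. unfold Rminus, Rdiv. now rewrite Rplus_opp_r, Rmult_0_l, Ropp_0, Rplus_0_l, Rabs_R0. }
  intros eps He.
  assert (Hc' : 0 < c) by lra.
  destruct (Hf (eps / c) (Rdiv_lt_0_compat _ _ He Hc')) as [d Hd].
  assert (Hdc : 0 < d / c) by (apply Rdiv_lt_0_compat; [apply d|easy]).
  exists (mkposreal _ Hdc); intros h Hh0 Hh; simpl in Hh.
  pose proof (Rabs_pos_lt h Hh0).
  assert (Hp : 0 < Rabs h * c) by nra.
  specialize (Hd (Rabs h * c)). rewrite Rplus_0_l in *.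
  rewrite Rabs_R0, Rmult_0_l, Rminus_0_r.
  rewrite Rminus_0_r in Hd.
  assert (Hlt : Rabs ((f (Rabs h * c) - f 0) / (Rabs h * c)) < eps / c).
  { apply Hd; [lra|]. rewrite Rabs_pos_eq by lra.
    apply (Rmult_lt_compat_r c) in Hh; [|easy]. now field_simplify in Hh; [|lra]. }
  replace (Rabs ((f (Rabs h * c) - f 0) / h))
    with (c * Rabs ((f (Rabs h * c) - f 0) / (Rabs h * c))).
  - apply (Rmult_lt_compat_l c) in Hlt; [|easy].
    now replace (c * (eps / c)) with eps in Hlt by (field; lra).
  - unfold Rdiv; rewrite !Rabs_mult, !Rabs_inv, Rabs_mult, Rabs_Rabsolu, (Rabs_pos_eq c) by easy.
    field; split; lra.
Qed.

Lemma is_dirD_radial (f f1 : R -> R) (p v : E2) :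
  (forall t, is_derive f t (t * f1 t)) ->
  is_dirD (V := E2) (fun p => f (radius p)) v p (f1 (radius p) * dot p v).
Proof.
  intros Hf. destruct (Rle_lt_or_eq_dec 0 (radius p) (radius_pos p)) as [Hr|Hr].
  - replace (f1 (radius p) * dot p v)
      with (radius p * f1 (radius p) * (dot p v / radius p)) by (field; lra).
    apply is_dirD_comp; [apply Hf|now apply is_dirD_radius].
  (* At the pole [dot p v] = 0, so the formula asks for derivative 0. *)
  - destruct (radius_0 p (eq_sym Hr)) as [Hx Hy]. rewrite <- Hr. unfold dot; rewrite Hx, Hy.
    replace (f1 0 * (0 * fst v + 0 * snd v)) with 0 by ring.
    unfold is_dirD. apply (is_derive_ext (fun s => f (Rabs s * radius v))).
    + intros s; f_equal. destruct p as [x y], v as [v1 v2]; simpl in Hx, Hy; subst.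
      unfold radius; simpl fst; simpl snd.
      rewrite <- (sqrt_Rsqr_abs s), <- sqrt_mult_alt by apply Rle_0_sqr.
      f_equal; unfold plus, scal; simpl; unfold mult; simpl; unfold Rsqr; ring.
    + apply is_derive_comp_Rabs; [apply radius_pos|].
      specialize (Hf 0); now rewrite Rmult_0_l in Hf.
Qed.

Lemma smooth_radial (f : R -> R) : radial f -> smooth (V := E2) (fun p => f (radius p)).
Proof.
  intros Hf n; revert f Hf; induction n as [|n IH]; intros f Hf.
  all: assert (Hc : forall p : E2, continuous (fun p : E2 => f (radius p)) p)
    by (intros p; apply (continuous_comp radius f);
        [apply continuous_radius|apply smooth_continuous, Hf]).
  - split; auto.
  - destruct (radial_Derive f Hf) as [f1 [H1 D]].
    apply (Ck_S n _ (fun v p => f1 (radius p) * dot p v)); auto.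
    + intros v p; now apply is_dirD_radial.
    + intros v; apply Ck_mult; [now apply IH|].
      apply smooth_plus; apply smooth_mult;
        first [apply smooth_const|apply smooth_fst_E2|apply smooth_snd_E2].
Qed.

(** [is_linear] includes an operator bound, so the map is assembled from bounded linear pieces. *)
Lemma is_linear_E2 A B :
  is_linear (U := E2) (V := R_NormedModule) (fun u => fst u * A + snd u * B).
Proof.
  apply (is_linear_comp (U := E2) (V := E2) (fun u => (fst u * A, snd u * B)) (fun u => plus (fst u) (snd u)));
    [|apply is_linear_plus].
  apply (is_linear_prod (T := E2) (U := R_NormedModule) (V := R_NormedModule)).
  - apply (is_linear_comp (U := E2) (V := R_NormedModule) fst (fun x => scal x A));
      [apply is_linear_fst|exact (is_linear_scal_l (K := R_AbsRing) (V := R_NormedModule) _)].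
  - apply (is_linear_comp (U := E2) (V := R_NormedModule) snd (fun x => scal x B));
      [apply is_linear_snd|exact (is_linear_scal_l (K := R_AbsRing) (V := R_NormedModule) _)].
Qed.

Lemma is_linear_TE2 A B C D :
  is_linear (U := TE2) (V := R_NormedModule)
    (fun u => (fst (fst u) * A + snd (fst u) * B) + (fst (snd u) * C + snd (snd u) * D)).
Proof.
  apply (is_linear_comp (U := TE2) (V := E2)
    (fun u => (fst (fst u) * A + snd (fst u) * B, fst (snd u) * C + snd (snd u) * D))
    (fun u => plus (fst u) (snd u))); [|apply is_linear_plus].
  apply (is_linear_prod (T := TE2) (U := R_NormedModule) (V := R_NormedModule)).
  - apply (is_linear_comp (U := TE2) (V := E2) fst (fun u => fst u * A + snd u * B));
      [apply is_linear_fst|apply is_linear_E2].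
  - apply (is_linear_comp (U := TE2) (V := E2) snd (fun u => fst u * C + snd u * D));
      [apply is_linear_snd|apply is_linear_E2].
Qed.

Lemma is_linear_eq (U : NormedModule R_AbsRing) (f g : U -> R) :
  (forall u, f u = g u) -> is_linear (V := R_NormedModule) g -> is_linear (V := R_NormedModule) f.
Proof. intros E H; now replace f with g by (apply functional_extensionality; auto). Qed.

(** * The orthonormal frame of a polar chart *)

(** Stated in the eta-expanded form that [auto_derive] leaves behind, so that it can be used for
    rewriting. *)
Lemma Derive_eta (f : R -> R) (x d : R) : is_derive f x d -> Derive (fun y : R => f y) x = d.
Proof. exact (is_derive_unique f x d). Qed.

Section Frame.
Variables k k1 k2 : R -> R.

(* With gam(t) = t + t^3 k(t), these are the components of [u] at [p] in the
   orthonormal coframe cos theta dt - sin theta gam dtheta,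
   sin theta dt + cos theta gam dtheta, which extends smoothly to the pole. *)
Definition twist (p u : E2) : R := k (radius p) * cross p u.
Definition frame1 (p u : E2) : R := fst u - snd p * twist p u.
Definition frame2 (p u : E2) : R := snd u + fst p * twist p u.

(** Derivatives in (p, u) along (a, b). With k1 = k' / t no division by the radius occurs, so they
    make sense at the pole. *)
Definition dtwist (p u a b : E2) : R :=
  k1 (radius p) * dot p a * cross p u + k (radius p) * (cross a u + cross p b).
Definition dframe1 (p u a b : E2) : R :=
  fst b - (snd a * twist p u + snd p * dtwist p u a b).
Definition dframe2 (p u a b : E2) : R :=
  snd b + (fst a * twist p u + fst p * dtwist p u a b).

(** Second derivatives, along (a, b) and then (a', b'). They are symmetric in the two directions,
    which [ext_d_contact_form] uses. *)
Definition d2twist (p u a b a' b' : E2) : R :=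
  k2 (radius p) * dot p a' * dot p a * cross p u + k1 (radius p) * dot a' a * cross p u
  + k1 (radius p) * dot p a * (cross a' u + cross p b')
  + k1 (radius p) * dot p a' * (cross a u + cross p b)
  + k (radius p) * (cross a' b + cross a b').
Definition d2frame1 (p u a b a' b' : E2) : R :=
  - (snd a * dtwist p u a' b' + (snd a' * dtwist p u a b + snd p * d2twist p u a b a' b')).
Definition d2frame2 (p u a b a' b' : E2) : R :=
  fst a * dtwist p u a' b' + (fst a' * dtwist p u a b + fst p * d2twist p u a b a' b').

Hypothesis Hk : forall t, is_derive k t (t * k1 t).
Hypothesis Hk1 : forall t, is_derive k1 t (t * k2 t).

Lemma is_derive_along_line (f f1 : R -> R) (p a : E2) :
  (forall t, is_derive f t (t * f1 t)) ->
  is_derive (fun s => f (radius (fst p + s * fst a, snd p + s * snd a))) 0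
    (f1 (radius p) * dot p a).
Proof.
  intros H. destruct p as [x y], a as [a1 a2].
  exact (is_dirD_radial f f1 (x, y) (a1, a2) H).
Qed.

Lemma is_derive_frame1 (p u a b : E2) :
  is_derive (fun s : R => frame1 (plus p (scal s a)) (plus u (scal s b))) 0 (dframe1 p u a b).
Proof.
  destruct p as [x y], u as [u1 u2], a as [a1 a2], b as [b1 b2].
  pose proof (is_derive_along_line k k1 (x, y) (a1, a2) Hk) as H.
  (* K is made opaque with its derivative at 0 known, so that [auto_derive] does not meet the square
     root in [radius]. *)
  set (K := fun s : R => k (radius (x + s * a1, y + s * a2))).
  change (is_derive K 0 (k1 (radius (x, y)) * dot (x, y) (a1, a2))) in H.
  change (is_derive (fun s => (u1 + s * b1) - (y + s * a2) * (K s *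
     ((x + s * a1) * (u2 + s * b2) - (y + s * a2) * (u1 + s * b1)))) 0
     (dframe1 (x, y) (u1, u2) (a1, a2) (b1, b2))).
  assert (E0 : K 0 = k (radius (x, y))) by (unfold K; now rewrite !Rmult_0_l, !Rplus_0_r).
  clearbody K; auto_derive; [eexists; exact H|].
  rewrite (Derive_eta K _ _ H), E0.
  unfold dframe1, dtwist, twist, dot, cross; simpl; ring.
Qed.

Lemma is_derive_frame2 (p u a b : E2) :
  is_derive (fun s : R => frame2 (plus p (scal s a)) (plus u (scal s b))) 0 (dframe2 p u a b).
Proof.
  destruct p as [x y], u as [u1 u2], a as [a1 a2], b as [b1 b2].
  pose proof (is_derive_along_line k k1 (x, y) (a1, a2) Hk) as H.
  set (K := fun s : R => k (radius (x + s * a1, y + s * a2))).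
  change (is_derive K 0 (k1 (radius (x, y)) * dot (x, y) (a1, a2))) in H.
  change (is_derive (fun s => (u2 + s * b2) + (x + s * a1) * (K s *
     ((x + s * a1) * (u2 + s * b2) - (y + s * a2) * (u1 + s * b1)))) 0
     (dframe2 (x, y) (u1, u2) (a1, a2) (b1, b2))).
  assert (E0 : K 0 = k (radius (x, y))) by (unfold K; now rewrite !Rmult_0_l, !Rplus_0_r).
  clearbody K; auto_derive; [eexists; exact H|].
  rewrite (Derive_eta K _ _ H), E0.
  unfold dframe2, dtwist, twist, dot, cross; simpl; ring.
Qed.

Lemma is_derive_dframe1 (p u a b a' b' : E2) :
  is_derive (fun s : R => dframe1 (plus p (scal s a')) (plus u (scal s b')) a b) 0
    (d2frame1 p u a b a' b').
Proof.
  destruct p as [x y], u as [u1 u2], a as [a1 a2], b as [b1 b2], a' as [c1 c2], b' as [d1 d2].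
  pose proof (is_derive_along_line k k1 (x, y) (c1, c2) Hk) as H.
  pose proof (is_derive_along_line k1 k2 (x, y) (c1, c2) Hk1) as H1.
  set (K := fun s : R => k (radius (x + s * c1, y + s * c2))).
  set (K1 := fun s : R => k1 (radius (x + s * c1, y + s * c2))).
  change (is_derive K 0 (k1 (radius (x, y)) * dot (x, y) (c1, c2))) in H.
  change (is_derive K1 0 (k2 (radius (x, y)) * dot (x, y) (c1, c2))) in H1.
  change (is_derive (fun s => b1 - (a2 * (K s * ((x + s * c1) * (u2 + s * d2) - (y + s * c2) * (u1 + s * d1)))
    + (y + s * c2) * (K1 s * ((x + s * c1) * a1 + (y + s * c2) * a2)
        * ((x + s * c1) * (u2 + s * d2) - (y + s * c2) * (u1 + s * d1))
      + K s * ((a1 * (u2 + s * d2) - a2 * (u1 + s * d1)) + ((x + s * c1) * b2 - (y + s * c2) * b1))))) 0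
     (d2frame1 (x, y) (u1, u2) (a1, a2) (b1, b2) (c1, c2) (d1, d2))).
  assert (E0 : K 0 = k (radius (x, y))) by (unfold K; now rewrite !Rmult_0_l, !Rplus_0_r).
  assert (E1 : K1 0 = k1 (radius (x, y))) by (unfold K1; now rewrite !Rmult_0_l, !Rplus_0_r).
  clearbody K K1; auto_derive; [repeat split; eexists; eassumption|].
  rewrite (Derive_eta K _ _ H), (Derive_eta K1 _ _ H1), E0, E1.
  unfold d2frame1, d2twist, dtwist, twist, dot, cross; simpl; ring.
Qed.

Lemma is_derive_dframe2 (p u a b a' b' : E2) :
  is_derive (fun s : R => dframe2 (plus p (scal s a')) (plus u (scal s b')) a b) 0
    (d2frame2 p u a b a' b').
Proof.
  destruct p as [x y], u as [u1 u2], a as [a1 a2], b as [b1 b2], a' as [c1 c2], b' as [d1 d2].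
  pose proof (is_derive_along_line k k1 (x, y) (c1, c2) Hk) as H.
  pose proof (is_derive_along_line k1 k2 (x, y) (c1, c2) Hk1) as H1.
  set (K := fun s : R => k (radius (x + s * c1, y + s * c2))).
  set (K1 := fun s : R => k1 (radius (x + s * c1, y + s * c2))).
  change (is_derive K 0 (k1 (radius (x, y)) * dot (x, y) (c1, c2))) in H.
  change (is_derive K1 0 (k2 (radius (x, y)) * dot (x, y) (c1, c2))) in H1.
  change (is_derive (fun s => b2 + (a1 * (K s * ((x + s * c1) * (u2 + s * d2) - (y + s * c2) * (u1 + s * d1)))
    + (x + s * c1) * (K1 s * ((x + s * c1) * a1 + (y + s * c2) * a2)
        * ((x + s * c1) * (u2 + s * d2) - (y + s * c2) * (u1 + s * d1))
      + K s * ((a1 * (u2 + s * d2) - a2 * (u1 + s * d1)) + ((x + s * c1) * b2 - (y + s * c2) * b1))))) 0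
     (d2frame2 (x, y) (u1, u2) (a1, a2) (b1, b2) (c1, c2) (d1, d2))).
  assert (E0 : K 0 = k (radius (x, y))) by (unfold K; now rewrite !Rmult_0_l, !Rplus_0_r).
  assert (E1 : K1 0 = k1 (radius (x, y))) by (unfold K1; now rewrite !Rmult_0_l, !Rplus_0_r).
  clearbody K K1; auto_derive; [repeat split; eexists; eassumption|].
  rewrite (Derive_eta K _ _ H), (Derive_eta K1 _ _ H1), E0, E1.
  unfold d2frame2, d2twist, dtwist, twist, dot, cross; simpl; ring.
Qed.

Lemma is_derive_frame_base1 (p u a : E2) :
  is_derive (fun s : R => frame1 (plus p (scal s a)) u) 0 (dframe1 p u a zero).
Proof.
  apply (is_derive_ext (fun s : R => frame1 (plus p (scal s a)) (plus u (scal s zero)))).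
  - intros s; now rewrite scal_zero_r, plus_zero_r.
  - apply is_derive_frame1.
Qed.

Lemma is_derive_frame_base2 (p u a : E2) :
  is_derive (fun s : R => frame2 (plus p (scal s a)) u) 0 (dframe2 p u a zero).
Proof.
  apply (is_derive_ext (fun s : R => frame2 (plus p (scal s a)) (plus u (scal s zero)))).
  - intros s; now rewrite scal_zero_r, plus_zero_r.
  - apply is_derive_frame2.
Qed.

End Frame.

Lemma dirD_radial_form (s s1 : R -> R) (p u v : E2) :
  (forall t, is_derive s t (t * s1 t)) ->
  is_dirD (V := E2) (fun q => s (radius q) * cross q v) u p
    (s1 (radius p) * dot p u * cross p v + s (radius p) * cross u v).
Proof.
  intros Hs. pose proof (is_dirD_radial s s1 p u Hs) as H.
  refine (is_dirD_mult _ (fun q => cross q v) u p _ (cross u v) H _).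
  destruct p as [x y], u as [u1 u2], v as [v1 v2].
  change (is_derive (fun r => (x + r * u1) * v2 - (y + r * u2) * v1) 0 (u1 * v2 - u2 * v1)).
  auto_derive; [easy|ring].
Qed.

(** The form is s(r) r^2 dtheta, so the factor must be (r^2 s)' / r; this is its expression without
    the quotient. *)
Lemma ext_d_radial_form (s s1 : R -> R) (p u v : E2) :
  (forall t, is_derive s t (t * s1 t)) ->
  ext_d (V := E2) (fun q w => s (radius q) * cross q w) p u v
    = (2 * s (radius p) + radius p ^ 2 * s1 (radius p)) * cross u v.
Proof.
  intros Hs; unfold ext_d.
  rewrite !(dirD_unique _ _ _ _ (dirD_radial_form s s1 _ _ _ Hs)), radius_sqr.
  unfold dot, cross; ring.
Qed.

(** * Symplectic form, Hamiltonian field and contact form in one chart *)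

Section Chart.
Variables (l : R) (gam : R -> R) (b : bool) (k k1 k2 : R -> R).
Hypothesis Hgam : forall t, gam (if b then t else l - t) = t + t ^ 3 * k t.

Lemma gam_lat p : gam (lat l b p) = radius p + radius p ^ 3 * k (radius p).
Proof. rewrite <- Hgam; unfold lat; now destruct b. Qed.

Lemma metric_frame p u v :
  metric l gam b p u v = frame1 k p u * frame1 k p v + frame2 k p u * frame2 k p v.
Proof.
  unfold metric; destruct (Req_EM_T (radius p) 0) as [H|H].
  - destruct (radius_0 p H) as [Hx Hy]; unfold frame1, frame2, twist, cross; rewrite Hx, Hy; ring.
  - rewrite gam_lat.
    (* Polarised Lagrange identity: it trades dt for dtheta and cancels the denominators r^2. *)
    assert (E : dot p u * dot p v = radius p ^ 2 * dot u v - cross p u * cross p v)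
      by (rewrite radius_sqr; unfold dot, cross; ring).
    transitivity (dot p u * dot p v / radius p ^ 2
      + (1 + radius p ^ 2 * k (radius p)) ^ 2 * (cross p u * cross p v) / radius p ^ 2).
    { unfold dt, dtheta; fold (dot p u) (dot p v) (cross p u) (cross p v); field; easy. }
    rewrite E.
    transitivity (dot u v + (2 * k (radius p) + radius p ^ 2 * k (radius p) ^ 2) * cross p u * cross p v);
      [field; easy|].
    rewrite radius_sqr; unfold frame1, frame2, twist, dot, cross; ring.
Qed.

Lemma area_frame p u v :
  area l gam b p u v = (1 + radius p ^ 2 * k (radius p)) * cross u v.
Proof.
  unfold area; destruct (Req_EM_T (radius p) 0) as [H|H].
  - rewrite H; unfold cross; ring.
  - rewrite gam_lat.
    assert (E : dot p u * cross p v - dot p v * cross p u = radius p ^ 2 * cross u v)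
      by (rewrite radius_sqr; unfold dot, cross; ring).
    transitivity ((1 + radius p ^ 2 * k (radius p)) *
       (dot p u * cross p v - dot p v * cross p u) / radius p ^ 2).
    { unfold dt, dtheta; fold (dot p u) (dot p v) (cross p u) (cross p v); field; easy. }
    rewrite E; field; easy.
Qed.

Hypothesis Hk : forall t, is_derive k t (t * k1 t).
Hypothesis Hk1 : forall t, is_derive k1 t (t * k2 t).

(** The w are the frame components of the fibre vector, the e are the coframe pulled back to the
    bundle, and the dw are the differentials of the w. *)
Let w1 (q : TE2) := frame1 k (fst q) (snd q).
Let w2 (q : TE2) := frame2 k (fst q) (snd q).
Let e1 (q xi : TE2) := frame1 k (fst q) (fst xi).
Let e2 (q xi : TE2) := frame2 k (fst q) (fst xi).
Let dw1 (q xi : TE2) := dframe1 k k1 (fst q) (snd q) (fst xi) (snd xi).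
Let dw2 (q xi : TE2) := dframe2 k k1 (fst q) (snd q) (fst xi) (snd xi).

Lemma lambda_frame : lambda l gam b = fun q xi => w1 q * e1 q xi + w2 q * e2 q xi.
Proof.
  apply functional_extensionality; intros q; apply functional_extensionality; intros xi.
  apply metric_frame.
Qed.

Lemma energy_frame q : energy l gam b q = / 2 * (w1 q ^ 2 + w2 q ^ 2).
Proof. unfold energy; rewrite metric_frame; unfold w1, w2; ring. Qed.

Lemma dirD_w1 xi q : is_dirD (V := TE2) w1 xi q (dw1 q xi).
Proof. exact (is_derive_frame1 k k1 Hk (fst q) (snd q) (fst xi) (snd xi)). Qed.

Lemma dirD_w2 xi q : is_dirD (V := TE2) w2 xi q (dw2 q xi).
Proof. exact (is_derive_frame2 k k1 Hk (fst q) (snd q) (fst xi) (snd xi)). Qed.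

Lemma dirD_energy q xi :
  dirD (V := TE2) (energy l gam b) xi q = w1 q * dw1 q xi + w2 q * dw2 q xi.
Proof.
  replace (energy l gam b : TE2 -> R) with (fun q => / 2 * (w1 q * w1 q + w2 q * w2 q)).
  2:{ apply functional_extensionality; intros; rewrite energy_frame; ring. }
  pose proof (is_dirD_mult _ _ _ _ _ _ (dirD_w1 xi q) (dirD_w1 xi q)) as P1.
  pose proof (is_dirD_mult _ _ _ _ _ _ (dirD_w2 xi q) (dirD_w2 xi q)) as P2.
  pose proof (is_dirD_mult _ _ _ _ _ _ (is_dirD_const (/ 2) xi q) (is_dirD_plus _ _ _ _ _ _ P1 P2)) as P.
  rewrite (dirD_unique _ _ _ _ P); field.
Qed.

Lemma dirD_lambda q xi eta :
  is_dirD (V := TE2) (fun q => w1 q * e1 q eta + w2 q * e2 q eta) xi q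
    (dw1 q xi * e1 q eta + w1 q * dframe1 k k1 (fst q) (fst eta) (fst xi) zero
     + (dw2 q xi * e2 q eta + w2 q * dframe2 k k1 (fst q) (fst eta) (fst xi) zero)).
Proof.
  apply is_dirD_plus; refine (is_dirD_mult _ _ _ _ _ _ _ _).
  - apply dirD_w1.
  - exact (is_derive_frame_base1 k k1 Hk (fst q) (fst eta) (fst xi)).
  - apply dirD_w2.
  - exact (is_derive_frame_base2 k k1 Hk (fst q) (fst eta) (fst xi)).
Qed.

(* The connection form (gam' - 1) dtheta of the frame. *)
Definition conn (p u : E2) : R :=
  (3 * k (radius p) + radius p ^ 2 * k1 (radius p)) * cross p u.

(** Covariant differentials of the components: dw corrected by the rotation of the frame, hence zero
    on horizontal vectors. *)
Let Dw1 (q xi : TE2) := dw1 q xi - w2 q * conn (fst q) (fst xi).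
Let Dw2 (q xi : TE2) := dw2 q xi + w1 q * conn (fst q) (fst xi).

(** Here lambda = w1 e1 + w2 e2. By the structure equations de1 = conn ^ e2 and de2 = - conn ^ e1,
    shown as [S1] and [S2], the connection terms combine with dw into covariant differentials. *)
Lemma ext_d_lambda q xi eta :
  ext_d (lambda l gam b) q xi eta
    = (Dw1 q xi * e1 q eta - Dw1 q eta * e1 q xi) + (Dw2 q xi * e2 q eta - Dw2 q eta * e2 q xi).
Proof.
  rewrite lambda_frame; unfold ext_d.
  rewrite !(dirD_unique _ _ _ _ (dirD_lambda q _ _)).
  unfold Dw1, Dw2, conn; rewrite radius_sqr.
  assert (S1 : dframe1 k k1 (fst q) (fst eta) (fst xi) zero - dframe1 k k1 (fst q) (fst xi) (fst eta) zero
     = conn (fst q) (fst xi) * e2 q eta - conn (fst q) (fst eta) * e2 q xi).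
  { unfold conn; rewrite radius_sqr; unfold dframe1, dtwist, e2, frame2, twist, dot, cross; simpl;
    unfold zero; simpl; ring. }
  assert (S2 : dframe2 k k1 (fst q) (fst eta) (fst xi) zero - dframe2 k k1 (fst q) (fst xi) (fst eta) zero
     = - (conn (fst q) (fst xi) * e1 q eta - conn (fst q) (fst eta) * e1 q xi)).
  { unfold conn; rewrite radius_sqr; unfold dframe2, dtwist, e1, frame1, twist, dot, cross; simpl;
    unfold zero; simpl; ring. }
  unfold conn in S1, S2; rewrite radius_sqr in S1, S2.
  match goal with |- _ = ?rhs => set (r := rhs) end.
  transitivity (dw1 q xi * e1 q eta - dw1 q eta * e1 q xi + (dw2 q xi * e2 q eta - dw2 q eta * e2 q xi)
    + w1 q * (dframe1 k k1 (fst q) (fst eta) (fst xi) zero - dframe1 k k1 (fst q) (fst xi) (fst eta) zero)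
    + w2 q * (dframe2 k k1 (fst q) (fst eta) (fst xi) zero - dframe2 k k1 (fst q) (fst xi) (fst eta) zero)).
  { ring. }
  rewrite S1, S2; unfold r; ring.
Qed.

Lemma area_coframe q xi eta :
  area l gam b (fst q) (fst xi) (fst eta) = e1 q xi * e2 q eta - e2 q xi * e1 q eta.
Proof.
  rewrite area_frame, radius_sqr; unfold e1, e2, frame1, frame2, twist, cross; ring.
Qed.

(* The horizontal part of X at (p, v) is v, and [w] rotates at unit speed
   relative to the connection; the velocity of v is obtained by inverting [frame]. *)
Definition magnetic_field (q : TE2) : TE2 :=
  let p := fst q in let v := snd q in
  let c := (w2 q * (conn p v - 1) - dframe1 k k1 p v v zero,
            w1 q * (1 - conn p v) - dframe2 k k1 p v v zero) : E2 in
  let h := k (radius p) / (1 + radius p ^ 2 * k (radius p)) * cross p c in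
  (v, (fst c + snd p * h, snd c - fst p * h)).

(** For fixed p the coframe is the identity plus a rank-one map, in the direction of p rotated by a
    right angle. The Sherman-Morrison formula inverts it; the determinant is 1 + r^2 k, that is gam
    / r off the pole. *)
Lemma frame_inverse (p : E2) c1 c2 :
  1 + radius p ^ 2 * k (radius p) <> 0 ->
  let h := k (radius p) / (1 + radius p ^ 2 * k (radius p)) * cross p (c1, c2) in
  frame1 k p (c1 + snd p * h, c2 - fst p * h) = c1 /\
  frame2 k p (c1 + snd p * h, c2 - fst p * h) = c2.
Proof.
  rewrite radius_sqr; destruct p as [x y].
  unfold frame1, frame2, twist, cross; cbn [fst snd]; generalize (k (radius (x, y))).
  intros K HD; split; field; exact HD.
Qed.

Lemma magnetic_field_frame q :
  1 + radius (fst q) ^ 2 * k (radius (fst q)) <> 0 ->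
  Dw1 q (magnetic_field q) = - w2 q /\ Dw2 q (magnetic_field q) = w1 q.
Proof.
  intros HD; set (p := fst q) in *; set (v := snd q).
  set (r := conn p v).
  set (c1 := w2 q * (r - 1) - dframe1 k k1 p v v zero).
  set (c2 := w1 q * (1 - r) - dframe2 k k1 p v v zero).
  set (h := k (radius p) / (1 + radius p ^ 2 * k (radius p)) * cross p (c1, c2)).
  (* [dframe1] is affine in its last argument with linear part [frame1], so the fibre velocity
     enters only through [frame_inverse]. *)
  assert (E1 : dframe1 k k1 p v v (c1 + snd p * h, c2 - fst p * h)
     = dframe1 k k1 p v v zero + c1).
  { transitivity (dframe1 k k1 p v v zero + frame1 k p (c1 + snd p * h, c2 - fst p * h)).
    - unfold dframe1, frame1, dtwist, twist, cross; simpl; unfold zero; simpl; ring.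
    - f_equal; now apply frame_inverse. }
  assert (E2 : dframe2 k k1 p v v (c1 + snd p * h, c2 - fst p * h)
     = dframe2 k k1 p v v zero + c2).
  { transitivity (dframe2 k k1 p v v zero + frame2 k p (c1 + snd p * h, c2 - fst p * h)).
    - unfold dframe2, frame2, dtwist, twist, cross; simpl; unfold zero; simpl; ring.
    - f_equal; now apply frame_inverse. }
  change (dframe1 k k1 p v v (c1 + snd p * h, c2 - fst p * h) - w2 q * r = - w2 q /\
    dframe2 k k1 p v v (c1 + snd p * h, c2 - fst p * h) + w1 q * r = w1 q).
  rewrite E1, E2; unfold c1, c2; split; ring.
Qed.

(** The quarter turn Dw(X) = (- w2, w1) cancels the area term. What remains is - (w1 Dw1 + w2 Dw2),
    which is - dE because the connection part is a rotation and drops out. *)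
Lemma magnetic_field_hamiltonian q eta :
  1 + radius (fst q) ^ 2 * k (radius (fst q)) <> 0 ->
  omega l gam b q (magnetic_field q) eta = - dirD (V := TE2) (energy l gam b) eta q.
Proof.
  intros HD; destruct (magnetic_field_frame q HD) as [H1 H2].
  unfold omega; rewrite ext_d_lambda, area_coframe, dirD_energy, H1, H2.
  change (e1 q (magnetic_field q)) with (w1 q).
  change (e2 q (magnetic_field q)) with (w2 q).
  unfold Dw1, Dw2; ring.
Qed.

(** [HSk] is the equation (t^2 S)' = t + t^3 k divided by t: it makes S r^2 dtheta a primitive of
    the area form, up to and including the pole. *)
Variables (S S1 : R -> R) (m : R).
Hypothesis Hm : 0 < m.
Hypothesis HS : forall t, is_derive S t (t * S1 t).
Hypothesis HSk : forall t, 2 * S t + t ^ 2 * S1 t = 1 + t ^ 2 * k t.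

(* lambda + d phi - (S r^2) dtheta, where phi is the angle of w; on the level
   |w| = m one has d phi = (w1 dw2 - w2 dw1) / m^2. *)
Definition contact_form (q xi : TE2) : R :=
  (w1 q * e1 q xi + w2 q * e2 q xi) + / m ^ 2 * (w1 q * dw2 q xi - w2 q * dw1 q xi)
  - S (radius (fst q)) * cross (fst q) (fst xi).

Lemma dirD_contact_form q xi eta :
  dirD (V := TE2) (fun q => contact_form q eta) xi q =
    dirD (V := TE2) (fun q => lambda l gam b q eta) xi q
    + / m ^ 2 * ((dw1 q xi * dw2 q eta
         + w1 q * d2frame2 k k1 k2 (fst q) (snd q) (fst eta) (snd eta) (fst xi) (snd xi))
       - (dw2 q xi * dw1 q eta
         + w2 q * d2frame1 k k1 k2 (fst q) (snd q) (fst eta) (snd eta) (fst xi) (snd xi)))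
    - dirD (V := E2) (fun p => S (radius p) * cross p (fst eta)) (fst xi) (fst q).
Proof.
  rewrite lambda_frame, (dirD_unique _ _ _ _ (dirD_lambda q xi eta)).
  rewrite (dirD_unique _ _ _ _ (dirD_radial_form S S1 _ _ _ HS)).
  apply dirD_unique. unfold is_dirD.
  assert (D2 : is_dirD (V := TE2) (fun q => dw2 q eta) xi q
    (d2frame2 k k1 k2 (fst q) (snd q) (fst eta) (snd eta) (fst xi) (snd xi)))
    by exact (is_derive_dframe2 k k1 k2 Hk Hk1 _ _ _ _ _ _).
  assert (D1 : is_dirD (V := TE2) (fun q => dw1 q eta) xi q
    (d2frame1 k k1 k2 (fst q) (snd q) (fst eta) (snd eta) (fst xi) (snd xi)))
    by exact (is_derive_dframe1 k k1 k2 Hk Hk1 _ _ _ _ _ _).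
  pose proof (is_dirD_mult _ _ _ _ _ _ (dirD_w1 xi q) D2) as P2.
  pose proof (is_dirD_mult _ _ _ _ _ _ (dirD_w2 xi q) D1) as P1.
  pose proof (dirD_lambda q xi eta) as PL.
  pose proof (dirD_radial_form S S1 (fst q) (fst xi) (fst eta) HS) as PS.
  unfold is_dirD in P1, P2, PL, PS.
  apply (is_derive_minus (V := R_NormedModule)); [|exact PS].
  apply (is_derive_plus (V := R_NormedModule)); [exact PL|].
  apply is_derive_scal.
  apply (is_derive_minus (V := R_NormedModule)); [exact P2|exact P1].
Qed.

(** The second derivatives of w cancel by symmetry. The leftover dw1 ^ dw2 appears because the angle
    form is written with the constant m^2 also off the level. *)
Lemma ext_d_contact_form q xi eta :
  ext_d contact_form q xi eta =
    omega l gam b q xi eta + 2 * / m ^ 2 * (dw1 q xi * dw2 q eta - dw1 q eta * dw2 q xi).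
Proof.
  unfold omega, ext_d at 1; rewrite !dirD_contact_form.
  rewrite area_frame, <- HSk, <- (ext_d_radial_form S S1) by easy.
  unfold ext_d.
  assert (Y1 : d2frame1 k k1 k2 (fst q) (snd q) (fst eta) (snd eta) (fst xi) (snd xi)
    = d2frame1 k k1 k2 (fst q) (snd q) (fst xi) (snd xi) (fst eta) (snd eta))
    by (unfold d2frame1, d2twist, dot, cross; ring).
  assert (Y2 : d2frame2 k k1 k2 (fst q) (snd q) (fst eta) (snd eta) (fst xi) (snd xi)
    = d2frame2 k k1 k2 (fst q) (snd q) (fst xi) (snd xi) (fst eta) (snd eta))
    by (unfold d2frame2, d2twist, dot, cross; ring).
  rewrite Y1, Y2; ring.
Qed.

(** Tangent vectors satisfy w1 dw1 + w2 dw2 = 0, so dw1 and dw2 are dependent there: |w|^2 dw1 ^ dw2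
    is the wedge of that vanishing form with w1 dw2 - w2 dw1. *)
Lemma contact_form_primitive q xi eta :
  energy l gam b q = m ^ 2 / 2 ->
  level_tangent (energy l gam b) q xi -> level_tangent (energy l gam b) q eta ->
  ext_d contact_form q xi eta = omega l gam b q xi eta.
Proof.
  unfold level_tangent; rewrite !dirD_energy, energy_frame; intros He Hxi Heta.
  rewrite ext_d_contact_form.
  enough (dw1 q xi * dw2 q eta - dw1 q eta * dw2 q xi = 0) as -> by ring.
  apply (Rmult_eq_reg_l (w1 q ^ 2 + w2 q ^ 2)); [|nra].
  transitivity ((w1 q * dw1 q xi + w2 q * dw2 q xi) * (w1 q * dw2 q eta - w2 q * dw1 q eta)
    - (w1 q * dw1 q eta + w2 q * dw2 q eta) * (w1 q * dw2 q xi - w2 q * dw1 q xi)); [ring|].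
  rewrite Hxi, Heta; ring.
Qed.

Lemma contact_form_field q :
  energy l gam b q = m ^ 2 / 2 ->
  1 + radius (fst q) ^ 2 * k (radius (fst q)) <> 0 ->
  contact_form q (magnetic_field q) = m ^ 2 + 1 - conn (fst q) (snd q)
    - S (radius (fst q)) * cross (fst q) (snd q).
Proof.
  rewrite energy_frame; intros He HD; destruct (magnetic_field_frame q HD) as [H1 H2].
  unfold contact_form.
  change (e1 q (magnetic_field q)) with (w1 q).
  change (e2 q (magnetic_field q)) with (w2 q).
  change (fst (magnetic_field q)) with (snd q).
  unfold Dw1 in H1; unfold Dw2 in H2. change (fst (magnetic_field q)) with (snd q) in H1, H2.
  replace (dw1 q (magnetic_field q)) with (- w2 q + w2 q * conn (fst q) (snd q)) by lra.
  replace (dw2 q (magnetic_field q)) with (w1 q - w1 q * conn (fst q) (snd q)) by lra.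
  assert (Em : w1 q ^ 2 + w2 q ^ 2 = m ^ 2) by lra.
  transitivity ((w1 q ^ 2 + w2 q ^ 2) + / m ^ 2 * ((w1 q ^ 2 + w2 q ^ 2) * (1 - conn (fst q) (snd q)))
     - S (radius (fst q)) * cross (fst q) (snd q)); [ring|].
  rewrite Em; field; lra.
Qed.

Hypothesis Rk : radial k.
Hypothesis Rk1 : radial k1.
Hypothesis RS : radial S.

Lemma contact_form_one_form (W : TE2 -> Prop) : one_form_on W contact_form.
Proof.
  split.
  - intros q _; eapply is_linear_eq;
      [|apply (is_linear_TE2 (contact_form q ((1, 0), (0, 0))) (contact_form q ((0, 1), (0, 0)))
                 (contact_form q ((0, 0), (1, 0))) (contact_form q ((0, 0), (0, 1))))].
    intros u; unfold contact_form, e1, e2, dw1, dw2, frame1, frame2, dframe1, dframe2, dtwist, twist, dot, cross.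
    cbn [fst snd]; ring.
  - intros xi; apply smooth_restrict.
    assert (Sk := smooth_fst_comp E2 E2 _ (smooth_radial k Rk)).
    assert (Sk1 := smooth_fst_comp E2 E2 _ (smooth_radial k1 Rk1)).
    assert (SS := smooth_fst_comp E2 E2 _ (smooth_radial S RS)).
    assert (Sx := smooth_fst_comp E2 E2 _ smooth_fst_E2).
    assert (Sy := smooth_fst_comp E2 E2 _ smooth_snd_E2).
    assert (Su := smooth_snd_comp E2 E2 _ smooth_fst_E2).
    assert (Sv := smooth_snd_comp E2 E2 _ smooth_snd_E2).
    unfold contact_form, e1, e2, dw1, dw2, w1, w2, frame1, frame2, dframe1, dframe2, dtwist, twist, dot, cross.
    repeat first [exact Sk | exact Sk1 | exact SS | exact Sx | exact Sy | exact Su | exact Sv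
      | apply smooth_const | apply smooth_minus | apply smooth_plus | apply smooth_mult].
Qed.

End Chart.

(** * Transition between the two charts *)

Section Transition.
Variable l : R.

Definition dtrans (p v : E2) : E2 :=
  let c := (l - radius p) / radius p in
  let f := l * dot p v / radius p ^ 3 in
  (c * fst v - f * fst p, - (c * snd v - f * snd p)).

(** The fibre part of the differential of [Ttrans]: c and h are the coefficients of [dtrans p v],
    and e and f are their derivatives along (a, b). *)
Definition d2trans (p v a b : E2) : E2 :=
  let c := (l - radius p) / radius p in
  let e := - l * dot p a / radius p ^ 3 in
  let f := l * ((dot a v + dot p b) / radius p ^ 3 - 3 * dot p v * dot p a / radius p ^ 5) in
  let h := l * dot p v / radius p ^ 3 in
  (c * fst b + e * fst v - f * fst p - h * fst a,
   - (c * snd b + e * snd v - f * snd p - h * snd a)).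

Lemma is_derive_radius_line (p v : E2) : 0 < radius p ->
  is_derive (fun s => radius (fst p + s * fst v, snd p + s * snd v)) 0 (dot p v / radius p).
Proof.
  intros H; destruct p as [x y], v as [v1 v2]; exact (is_dirD_radius (x, y) (v1, v2) H).
Qed.

Lemma d_transE (p v : E2) : 0 < radius p -> d_trans l p v = dtrans p v.
Proof.
  intros Hr; pose proof (is_derive_radius_line p v Hr) as H.
  destruct p as [x y], v as [v1 v2].
  set (K := fun s : R => radius (x + s * v1, y + s * v2)).
  change (is_derive K 0 (dot (x, y) (v1, v2) / radius (x, y))) in H.
  assert (E0 : K 0 = radius (x, y)) by (unfold K; now rewrite !Rmult_0_l, !Rplus_0_r).
  unfold d_trans, velocity, dtrans; cbv zeta.
  change ((Derive (fun s => (l - K s) / K s * (x + s * v1)) 0,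
    Derive (fun s => - ((l - K s) / K s * (y + s * v2))) 0)
   = ((l - radius (x, y)) / radius (x, y) * v1 - l * dot (x, y) (v1, v2) / radius (x, y) ^ 3 * x,
     - ((l - radius (x, y)) / radius (x, y) * v2 - l * dot (x, y) (v1, v2) / radius (x, y) ^ 3 * y))).
  clearbody K.
  assert (HK : K 0 <> 0) by (rewrite E0; lra).
  f_equal; apply is_derive_unique; auto_derive;
    try (repeat apply conj; first [exact I | exact HK | eexists; exact H]);
    rewrite (Derive_eta K _ _ H), E0; field; lra.
Qed.

Lemma locally_radius_pos (p a : E2) : 0 < radius p ->
  locally 0 (fun s : R => 0 < radius (plus p (scal s a))).
Proof.
  intros Hr.
  apply (continuous_comp (fun s : R => plus p (scal s a)) radius 0).
  - apply (continuous_line (V := E2)).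
  - apply continuous_radius.
  - change (plus p (scal 0 a)) with (plus p (scal (0 : R) a)); rewrite at_line_0.
    now apply open_gt.
Qed.

Lemma velocity_d_trans (p v a b : E2) : 0 < radius p ->
  velocity (fun s => d_trans l (plus p (scal s a)) (plus v (scal s b))) = d2trans p v a b.
Proof.
  intros Hr; pose proof (is_derive_radius_line p a Hr) as H.
  pose proof (locally_radius_pos p a Hr) as Hl.
  unfold velocity.
  (* The closed formula for [d_trans] holds off the origin, so it is substituted on a neighbourhood
     of s = 0 only. *)
  rewrite (Derive_ext_loc _ (fun s => fst (dtrans (plus p (scal s a)) (plus v (scal s b))))).
  2:{ generalize Hl; apply filter_imp; intros s Hs; now rewrite d_transE. }
  rewrite (Derive_ext_loc (fun s => snd _) (fun s => snd (dtrans (plus p (scal s a)) (plus v (scal s b))))).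
  2:{ generalize Hl; apply filter_imp; intros s Hs; now rewrite d_transE. }
  clear Hl.
  destruct p as [x y], v as [v1 v2], a as [a1 a2], b as [b1 b2].
  set (K := fun s : R => radius (x + s * a1, y + s * a2)).
  change (is_derive K 0 (dot (x, y) (a1, a2) / radius (x, y))) in H.
  assert (E0 : K 0 = radius (x, y)) by (unfold K; now rewrite !Rmult_0_l, !Rplus_0_r).
  change ((Derive (fun s => (l - K s) / K s * (v1 + s * b1)
      - l * ((x + s * a1) * (v1 + s * b1) + (y + s * a2) * (v2 + s * b2)) / K s ^ 3 * (x + s * a1)) 0,
    Derive (fun s => - ((l - K s) / K s * (v2 + s * b2)
      - l * ((x + s * a1) * (v1 + s * b1) + (y + s * a2) * (v2 + s * b2)) / K s ^ 3 * (y + s * a2))) 0)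
   = d2trans (x, y) (v1, v2) (a1, a2) (b1, b2)).
  clearbody K.
  unfold d2trans; cbv zeta.
  assert (HK : K 0 <> 0) by (rewrite E0; lra).
  f_equal; apply is_derive_unique; auto_derive;
    try (repeat apply conj; first [exact I | exact HK | eexists; exact H | apply (pow_nonzero _ 3 HK)]);
    rewrite (Derive_eta K _ _ H), E0; unfold dot; simpl fst; simpl snd; field; lra.
Qed.

Lemma radius_trans p : overlap l p -> radius (trans l p) = l - radius p.
Proof.
  destruct p as [x y]; intros [H1 H2]; pose proof (radius_sqr (x, y)) as E.
  unfold radius at 1, trans; cbn [fst snd] in *; set (r := radius (x, y)) in *; clearbody r.
  match goal with |- sqrt ?e = _ => replace e with ((l - r) ^ 2) end.
  - rewrite <- Rsqr_pow2; apply sqrt_Rsqr; lra.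
  - transitivity (((l - r) / r) ^ 2 * (x ^ 2 + y ^ 2)); [rewrite <- E; field; lra|ring].
Qed.

Lemma overlap_trans p : overlap l p -> overlap l (trans l p).
Proof. intros H; unfold overlap; rewrite radius_trans by easy; destruct H; split; lra. Qed.

Lemma dot_trans p v : overlap l p ->
  dot (trans l p) (d_trans l p v) = - ((l - radius p) / radius p) * dot p v.
Proof.
  intros [H1 H2]; rewrite d_transE by easy.
  transitivity ((l - radius p) / radius p * ((l - radius p) / radius p * dot p v
    - l * dot p v / radius p ^ 3 * (fst p ^ 2 + snd p ^ 2))).
  - unfold dtrans, trans, dot; cbn [fst snd]; ring.
  - rewrite <- radius_sqr; field; lra.
Qed.

Lemma cross_trans p v : overlap l p ->
  cross (trans l p) (d_trans l p v) = - ((l - radius p) / radius p) ^ 2 * cross p v.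
Proof.
  intros [H1 H2]; rewrite d_transE by easy.
  unfold dtrans, trans, cross; cbn [fst snd]; ring.
Qed.

Lemma dt_trans p v : overlap l p -> dt (trans l p) (d_trans l p v) = - dt p v.
Proof.
  intros H; unfold dt; fold (dot (trans l p) (d_trans l p v)) (dot p v).
  rewrite dot_trans, radius_trans by easy; destruct H; field; lra.
Qed.

Lemma dtheta_trans p v : overlap l p -> dtheta (trans l p) (d_trans l p v) = - dtheta p v.
Proof.
  intros H; unfold dtheta; fold (cross (trans l p) (d_trans l p v)) (cross p v).
  rewrite cross_trans, radius_trans by easy; destruct H; field; lra.
Qed.

Lemma lat_trans b p : overlap l p -> lat l (negb b) (trans l p) = lat l b p.
Proof. intros H; destruct b; simpl; rewrite radius_trans by easy; ring. Qed.

Lemma metric_trans gam b p u v : overlap l p ->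
  metric l gam (negb b) (trans l p) (d_trans l p u) (d_trans l p v) = metric l gam b p u v.
Proof.
  intros H; unfold metric.
  rewrite !dt_trans, !dtheta_trans, lat_trans, radius_trans by easy.
  destruct H; destruct (Req_EM_T (l - radius p) 0); [lra|].
  destruct (Req_EM_T (radius p) 0); [lra|ring].
Qed.

(* Differentials of the components dt(v) and dtheta(v) of the velocity. *)
Definition ddt (p v a b : E2) : R :=
  (dot a v + dot p b) / radius p - dot p v * dot p a / radius p ^ 3.
Definition ddtheta (p v a b : E2) : R :=
  (cross a v + cross p b) / radius p ^ 2 - 2 * cross p v * dot p a / radius p ^ 4.

(** This is the derivative of [dt_trans]. Once every vector is reduced to dot products, an identity
    of rational functions remains. *)
Lemma ddt_trans p v a b : overlap l p ->
  ddt (trans l p) (d_trans l p v) (d_trans l p a) (d2trans p v a b) = - ddt p v a b.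
Proof.
  intros H; unfold ddt; rewrite !dot_trans, radius_trans by easy; destruct H as [H1 H2].
  rewrite !d_transE by easy.
  set (c := (l - radius p) / radius p).
  set (e := - l * dot p a / radius p ^ 3).
  set (f := l * ((dot a v + dot p b) / radius p ^ 3 - 3 * dot p v * dot p a / radius p ^ 5)).
  set (h := l * dot p v / radius p ^ 3).
  replace (dot (dtrans p a) (dtrans p v))
    with (c ^ 2 * dot a v + c * e * dot p v - c * h * dot p a - h * e * (fst p ^ 2 + snd p ^ 2)).
  2:{ unfold dtrans; fold c h; cbv zeta.
      replace (l * dot p a / radius p ^ 3) with (- e) by (unfold e; field; lra).
      unfold dot; cbn [fst snd]; ring. }
  replace (dot (trans l p) (d2trans p v a b))
    with (c * (c * dot p b + e * dot p v - f * (fst p ^ 2 + snd p ^ 2) - h * dot p a)).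
  2:{ unfold d2trans, trans; fold c e f h; cbv zeta. clearbody c e f h.
      unfold dot; cbn [fst snd]; ring. }
  rewrite <- radius_sqr; unfold c, e, f, h.
  generalize (dot a v) (dot p v) (dot p a) (dot p b); intros; field; lra.
Qed.

Lemma ddtheta_trans p v a b : overlap l p ->
  ddtheta (trans l p) (d_trans l p v) (d_trans l p a) (d2trans p v a b) = - ddtheta p v a b.
Proof.
  intros H; unfold ddtheta; rewrite !dot_trans, cross_trans, radius_trans by easy; destruct H as [H1 H2].
  rewrite !d_transE by easy.
  set (c := (l - radius p) / radius p).
  set (e := - l * dot p a / radius p ^ 3).
  set (f := l * ((dot a v + dot p b) / radius p ^ 3 - 3 * dot p v * dot p a / radius p ^ 5)).
  set (h := l * dot p v / radius p ^ 3).
  replace (cross (dtrans p a) (dtrans p v))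
    with (- (c ^ 2 * cross a v + c * e * cross p v + c * h * cross p a)).
  2:{ unfold dtrans; fold c h; cbv zeta.
      replace (l * dot p a / radius p ^ 3) with (- e) by (unfold e; field; lra).
      unfold cross; cbn [fst snd]; ring. }
  replace (cross (trans l p) (d2trans p v a b))
    with (- (c * (c * cross p b + e * cross p v - h * cross p a))).
  2:{ unfold d2trans, trans; fold c e f h; cbv zeta. clearbody c e f h.
      unfold cross; cbn [fst snd]; ring. }
  unfold c, e, h.
  generalize (cross a v) (cross p v) (dot p a) (cross p b) (cross p a) (dot p v); intros; field; lra.
Qed.

(** The frame of the chart is the polar frame turned by theta, so the angle of v is its polar angle
    plus theta; this gives the 1 in 1 - r^2 S. All polar terms have a known sign under [trans], so
    the gluing of the charts is checked in this form. *)
Lemma contact_form_polar (gam : R -> R) (b : bool) (k k1 S : R -> R) (m : R) (q xi : TE2) :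
  (forall t, gam (if b then t else l - t) = t + t ^ 3 * k t) ->
  0 < m -> 0 < radius (fst q) -> energy l gam b q = m ^ 2 / 2 ->
  let p := fst q in let v := snd q in let r := radius p in
  let g := r + r ^ 3 * k r in let g' := 1 + 3 * r ^ 2 * k r + r ^ 4 * k1 r in
  contact_form k k1 S m q xi =
    metric l gam b p v (fst xi)
    + / m ^ 2 * (dt p v * (g' * dt p (fst xi) * dtheta p v + g * ddtheta p v (fst xi) (snd xi))
        - g * dtheta p v * ddt p v (fst xi) (snd xi))
    + (1 - r ^ 2 * S r) * dtheta p (fst xi).
Proof.
  intros Hg Hm Hr He; cbv zeta.
  rewrite (energy_frame l gam b k Hg) in He.
  rewrite (metric_frame l gam b k Hg).
  unfold contact_form.
  set (p := fst q) in *; set (v := snd q) in *; set (a := fst xi); set (b' := snd xi).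
  assert (Em : frame1 k p v ^ 2 + frame2 k p v ^ 2 = m ^ 2) by lra.
  enough (Ekey : frame1 k p v * dframe2 k k1 p v a b' - frame2 k p v * dframe1 k k1 p v a b'
    = (dt p v * ((1 + 3 * radius p ^ 2 * k (radius p) + radius p ^ 4 * k1 (radius p)) * dt p a * dtheta p v
        + (radius p + radius p ^ 3 * k (radius p)) * ddtheta p v a b')
       - (radius p + radius p ^ 3 * k (radius p)) * dtheta p v * ddt p v a b')
      + (frame1 k p v ^ 2 + frame2 k p v ^ 2) * dtheta p a).
  { rewrite Ekey, Em.
    replace (cross p a) with (radius p ^ 2 * dtheta p a)
      by (unfold dtheta; fold (cross p a); field; lra).
    field; lra. }
  clear Em He.
  assert (EL : frame1 k p v * dframe2 k k1 p v a b' - frame2 k p v * dframe1 k k1 p v a b'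
    = cross v b' + (k1 (radius p) * dot p a * cross p v + k (radius p) * (cross a v + cross p b')) * dot p v
      + k (radius p) * cross p v * (dot a v - dot p b') + k (radius p) ^ 2 * cross p v ^ 2 * cross p a)
    by (unfold frame1, frame2, dframe1, dframe2, dtwist, twist, dot, cross; ring).
  assert (EN : frame1 k p v ^ 2 + frame2 k p v ^ 2
    = dot v v + 2 * k (radius p) * cross p v ^ 2 + k (radius p) ^ 2 * cross p v ^ 2 * radius p ^ 2)
    by (rewrite radius_sqr; unfold frame1, frame2, twist, dot, cross; ring).
  (* [I1] and [I2] expand vectors in the orthogonal basis formed by p and its rotation, after which
     only scalars remain for [field]. *)
  assert (I1 : cross v b' = (dot p v * (cross a v + cross p b') - cross p v * (dot a v + dot p b')
      + dot v v * cross p a) / radius p ^ 2).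
  { apply (Rmult_eq_reg_r (radius p ^ 2)); [|apply pow_nonzero; lra].
    transitivity (dot p v * (cross a v + cross p b') - cross p v * (dot a v + dot p b')
      + dot v v * cross p a); [|field; lra].
    rewrite radius_sqr; unfold dot, cross; ring. }
  assert (I2 : dot a v = (dot p v * dot p a + cross p v * cross p a) / radius p ^ 2).
  { apply (Rmult_eq_reg_r (radius p ^ 2)); [|apply pow_nonzero; lra].
    transitivity (dot p v * dot p a + cross p v * cross p a); [|field; lra].
    rewrite radius_sqr; unfold dot, cross; ring. }
  rewrite EL, EN, I1; unfold dt, dtheta, ddt, ddtheta.
  fold (dot p v) (dot p a) (cross p v) (cross p a).
  rewrite I2; generalize (cross a v + cross p b') (dot p v) (cross p v) (dot p a) (cross p a) (dot p b') (dot v v).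
  generalize (k (radius p)) (k1 (radius p)); intros; field; lra.
Qed.

End Transition.

(** * Charts of a normalised profile *)

Lemma radial_plus (f g : R -> R) : radial f -> radial g -> radial (fun t => f t + g t).
Proof.
  intros [Hf Hf'] [Hg Hg']; split; [now apply smooth_plus|].
  intros k; rewrite Derive_n_plus, Hf', Hg'; [ring| |];
    apply filter_forall; intros; now apply smooth_ex_derive_n.
Qed.

Lemma radial_const c : radial (fun _ => c).
Proof.
  split; [apply smooth_const|].
  intros k; rewrite Nat.add_1_r, Derive_n_const; reflexivity.
Qed.

Lemma radial_minus_const (f : R -> R) c : radial f -> radial (fun t => f t - c).
Proof. intros Hf; apply radial_plus; [easy|apply radial_const]. Qed.

Lemma Derive2_sqr_mult (F s : R -> R) :
  smooth s -> (forall t, F t = t ^ 2 * s t) -> Derive_n F 2 0 = 2 * s 0.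
Proof.
  intros Hs E.
  rewrite (Derive_n_ext _ (fun t => t * (t * s t))) by (intros; rewrite E; ring).
  rewrite Derive_n_id_mult by (apply smooth_mult; [apply smooth_R_id|easy]).
  rewrite (Derive_n_id_mult s 0) by easy. simpl; ring.
Qed.

Lemma is_derive_sqr_mult (s s1 : R -> R) t :
  is_derive s t (t * s1 t) ->
  is_derive (fun t => t ^ 2 * s t) t (t * (2 * s t + t ^ 2 * s1 t)).
Proof.
  intros H; auto_derive; [eexists; exact H|].
  rewrite (Derive_eta s _ _ H); ring.
Qed.

(** The smooth quotients through which all forms of a chart are written. The suffix 1 means the
    derivative divided by t, and 2 the same operation repeated. *)
Record chart_data (g : R -> R) := {
  cd_k : R -> R; cd_k1 : R -> R; cd_k2 : R -> R;
  cd_S : R -> R; cd_S1 : R -> R;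
  cd_s : R -> R; cd_s1 : R -> R;
  cd_rk : radial cd_k; cd_rk1 : radial cd_k1; cd_rS : radial cd_S; cd_rs : radial cd_s;
  cd_g : forall t, g t = t + t ^ 3 * cd_k t;
  cd_dk : forall t, is_derive cd_k t (t * cd_k1 t);
  cd_dk1 : forall t, is_derive cd_k1 t (t * cd_k2 t);
  cd_dS : forall t, is_derive cd_S t (t * cd_S1 t);
  cd_ds : forall t, is_derive cd_s t (t * cd_s1 t);
  cd_area : forall t, t ^ 2 * cd_S t = RInt g 0 t;
  cd_Sk : forall t, 2 * cd_S t + t ^ 2 * cd_S1 t = 1 + t ^ 2 * cd_k t;
  cd_slope : forall t, t ^ 2 * cd_s t = Derive g t - 1;
  cd_slope' : forall t, t * (2 * cd_s t + t ^ 2 * cd_s1 t) = Derive_n g 2 t;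
  cd_s0 : 2 * cd_s 0 = Derive_n g 3 0
}.

(** Hadamard's lemma yields the quotients only as existence in Prop, while [chart_data] lives in
    Type; hence the existential over [True]. *)
Lemma chart_data_exists (g : R -> R) :
  smooth g -> (forall k, Derive_n g (2 * k) 0 = 0) -> Derive g 0 = 1 ->
  exists _ : chart_data g, True.
Proof.
  intros Hg He H1.
  destruct (smooth_divisible g Hg (He 0%nat)) as [q [Hq Eq]].
  assert (Rq : radial q) by now apply (radial_quot g).
  assert (q0 : q 0 = 1).
  { rewrite <- H1. change (Derive g 0) with (Derive_n g 1 0).
    rewrite (Derive_n_ext _ _ _ _ Eq), (Derive_n_id_mult q 0) by easy. simpl; ring. }
  destruct (radial_div_sqr (fun t => q t - 1)) as [k [Rk Ek]];
    [now apply radial_minus_const|lra|].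
  destruct (radial_Derive k Rk) as [k1 [Rk1 Dk]].
  destruct (radial_Derive k1 Rk1) as [k2 [Rk2 Dk1]].
  destruct (radial_primitive_derivative g Hg He) as [RG RD].
  destruct (smooth_primitive g Hg) as [_ DG].
  destruct (radial_div_sqr (RInt g 0) RG) as [S [RS ES]]; [exact (RInt_point 0 g)|].
  destruct (radial_Derive S RS) as [S1 [RS1 DS]].
  destruct (radial_div_sqr (fun t => Derive g t - 1)) as [s [Rs Es]];
    [now apply radial_minus_const|lra|].
  destruct (radial_Derive s Rs) as [s1 [Rs1 Ds]].
  assert (Eg : forall t, g t = t + t ^ 3 * k t).
  { intros t; rewrite Eq; replace (q t) with (1 + t ^ 2 * k t) by (rewrite <- Ek; ring); ring. }
  assert (Sg : forall t, t * (2 * S t + t ^ 2 * S1 t) = g t).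
  { intros t; rewrite <- (is_derive_unique _ _ _ (is_derive_sqr_mult S S1 t (DS t))).
    rewrite <- (is_derive_unique _ _ _ (DG t)). apply Derive_ext; intros; now rewrite ES. }
  unshelve eexists; [|easy].
  refine {| cd_k := k; cd_k1 := k1; cd_k2 := k2; cd_S := S; cd_S1 := S1; cd_s := s; cd_s1 := s1 |}; auto.
  (* Dividing (t^2 S)' = g by t works off 0. At 0 the claim is 2 S(0) = 1, where 2 S(0) is the
     second derivative of int g, that is g'(0). *)
  - intros t; destruct (Req_dec t 0) as [->|Ht].
    + rewrite pow_ne_zero by easy. rewrite !Rmult_0_l, !Rplus_0_r, <- (Derive2_sqr_mult _ S (proj1 RS) ES).
      rewrite <- H1; apply Derive_ext; intros; now apply is_derive_unique.
    + apply (Rmult_eq_reg_l t); [|easy]. rewrite Sg, Eg; ring.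
  - intros t; rewrite <- (is_derive_unique _ _ _ (is_derive_sqr_mult s s1 t (Ds t))).
    change (Derive_n g 2 t) with (Derive (Derive g) t).
    rewrite (Derive_ext _ (fun t => Derive g t - 1)) by (intros; now rewrite Es).
    rewrite Derive_minus, Derive_const; [ring| |apply ex_derive_const].
    apply (smooth_ex_derive_n g 2 t Hg).
  - rewrite <- (Derive2_sqr_mult _ s (proj1 Rs) Es).
    rewrite (Derive_n_minus (Derive g) (fun _ => 1)), Derive_n_const.
    + change (Derive g) with (Derive_n g 1); rewrite Derive_n_comp, Rminus_0_r; reflexivity.
    + apply filter_forall; intros; apply smooth_ex_derive_n; now apply smooth_Derive.
    + apply filter_forall; intros; apply smooth_ex_derive_n, smooth_const.
Qed.

Lemma Derive_n_reflect (f : R -> R) l n t :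
  smooth f -> Derive_n (fun t => f (l - t)) n t = (-1) ^ n * Derive_n f n (l - t).
Proof.
  intros Hf; revert t; induction n as [|n IH]; intros t; [simpl; ring|].
  change (Derive (Derive_n (fun t => f (l - t)) n) t = (-1) ^ S n * Derive_n f (S n) (l - t)).
  rewrite (Derive_ext _ _ t IH). apply is_derive_unique.
  pose proof (smooth_is_derive _ (l - t) (smooth_Derive_n f n Hf)) as H.
  evar_last.
  - apply (is_derive_scal (fun t => Derive_n f n (l - t)) t ((-1) ^ n)).
    apply (is_derive_comp (V := R_NormedModule) (Derive_n f n) (fun t => l - t)); [exact H|].
    auto_derive; easy.
  - change ((-1) ^ n * (- (1) * Derive_n f (S n) (l - t)) = -1 * (-1) ^ n * Derive_n f (S n) (l - t)).
    ring.
Qed.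

Definition chart_profile (l : R) (gam : R -> R) (b : bool) (t : R) : R :=
  gam (if b then t else l - t).

Section Profile.
Variables (l : R) (gam : R -> R).
Hypothesis Hp : normalised_profile l gam.

Lemma profile_smooth : smooth gam.
Proof. apply smooth_of_ex_derive_n, Hp. Qed.

Lemma chart_profile_smooth b : smooth (chart_profile l gam b).
Proof.
  destruct b; [exact profile_smooth|].
  apply (smooth_comp R_NormedModule gam (fun t => l - t)); [exact profile_smooth|].
  apply smooth_minus; [apply smooth_const|apply smooth_R_id].
Qed.

Lemma Derive_n_chart_profile b n t :
  Derive_n (chart_profile l gam b) n t
    = (if b then 1 else (-1) ^ n) * Derive_n gam n (if b then t else l - t).
Proof.
  destruct b; [symmetry; apply Rmult_1_l|].
  apply (Derive_n_reflect gam l n t profile_smooth).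
Qed.

Lemma Derive_chart_profile b t :
  Derive (chart_profile l gam b) t = (if b then 1 else -1) * Derive gam (if b then t else l - t).
Proof.
  rewrite (Derive_n_chart_profile b 1 t : Derive _ _ = _).
  destruct b; [reflexivity|].
  change ((-1) ^ 1 * Derive gam (l - t) = -1 * Derive gam (l - t)); ring.
Qed.

Lemma chart_profile_negb b t : chart_profile l gam (negb b) (l - t) = chart_profile l gam b t.
Proof. unfold chart_profile; destruct b; simpl; f_equal; ring. Qed.

Lemma Derive_chart_profile_negb b t :
  Derive (chart_profile l gam (negb b)) (l - t) = - Derive (chart_profile l gam b) t.
Proof.
  rewrite !Derive_chart_profile; destruct b; simpl;
    [replace (l - (l - t)) with t by ring|]; ring.
Qed.

Lemma chart_data_profile b : exists _ : chart_data (chart_profile l gam b), True.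
Proof.
  apply chart_data_exists.
  - apply chart_profile_smooth.
  - intros k; rewrite Derive_n_chart_profile.
    destruct (np_even _ _ Hp k) as [H0 Hl]; destruct b; cbv iota; rewrite ?Rminus_0_r, ?H0, ?Hl; ring.
  - rewrite Derive_chart_profile.
    destruct b; cbv iota; rewrite ?Rminus_0_r, ?(np_dleft _ _ Hp), ?(np_dright _ _ Hp); ring.
Qed.

Lemma area_chart_profile b t :
  RInt (chart_profile l gam (negb b)) 0 (l - t) = 2 - RInt (chart_profile l gam b) 0 t.
Proof.
  assert (G : forall t, RInt (chart_profile l gam false) 0 t = 2 - RInt gam 0 (l - t)).
  { intros u. destruct (smooth_primitive gam profile_smooth) as [_ DG].
    rewrite <- (is_RInt_unique _ _ _ _ (np_area _ _ Hp)).
    replace (RInt gam 0 l - RInt gam 0 (l - u)) with (- RInt gam 0 (l - u) - - RInt gam 0 (l - 0))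
      by (rewrite Rminus_0_r; ring).
    apply is_RInt_unique.
    apply (is_RInt_derive (V := R_CompleteNormedModule) (fun u => - RInt gam 0 (l - u))).
    - intros x _; evar_last.
      + apply (is_derive_opp (V := R_NormedModule) (fun u => RInt gam 0 (l - u))).
        apply (is_derive_comp (V := R_NormedModule) (RInt gam 0) (fun u => l - u)); [apply DG|].
        auto_derive; easy.
      + change (- (- (1) * gam (l - x)) = gam (l - x)); ring.
    - intros x _; apply smooth_continuous, chart_profile_smooth. }
  destruct b; simpl; rewrite G.
  - now replace (l - (l - t)) with t by ring.
  - change (chart_profile l gam true) with gam.
    generalize (RInt gam 0 (l - t) : R); intros x; change (x = 2 - (2 - x)); ring.
Qed.

(* The coefficient of dtheta in the rotation-invariant primitive of (1 - K) mu,
   which vanishes at both poles. *)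
Definition primitive_coeff (t : R) : R := RInt gam 0 t - 1 + Derive gam t.

Lemma primitive_coeff_chart b t :
  RInt (chart_profile l gam b) 0 t + (Derive (chart_profile l gam b) t - 1)
    = (if b then 1 else -1) * primitive_coeff (if b then t else l - t).
Proof.
  rewrite Derive_chart_profile; unfold primitive_coeff; destruct b.
  - change (chart_profile l gam true) with gam; ring.
  - pose proof (area_chart_profile false t) as E; simpl in E.
    change (chart_profile l gam true) with gam in E; rewrite E; ring.
Qed.

Lemma disc_lat b p : disc l p -> 0 <= lat l b p <= l.
Proof.
  unfold disc; intros H; pose proof (radius_pos p); destruct b; simpl; lra.
Qed.

Lemma lat_if (b : bool) p : (if b then radius p else l - radius p) = lat l b p.
Proof. now destruct b. Qed.

(** * The upper bound for m_gamma and the contact property, given |B| <= gam *)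

Section Data.
Variable D : forall b, chart_data (chart_profile l gam b).

Lemma gam_chart (b : bool) t : gam (if b then t else l - t) = t + t ^ 3 * cd_k _ (D b) t.
Proof. exact (cd_g _ (D b) t). Qed.

Lemma chart_nondegenerate b p :
  disc l p -> 0 < 1 + radius p ^ 2 * cd_k _ (D b) (radius p).
Proof.
  intros Hd; unfold disc in Hd; pose proof (radius_pos p).
  destruct (Req_dec (radius p) 0) as [H0|H0]; [rewrite H0; lra|].
  apply (Rmult_lt_reg_l (radius p)); [lra|].
  rewrite Rmult_0_r.
  replace (radius p * _) with (gam (if b then radius p else l - radius p))
    by (rewrite gam_chart; ring).
  apply (np_pos _ _ Hp); destruct b; lra.
Qed.

(* The one-form primitive_coeff(t) dtheta. *)
Definition invariant_primitive (b : bool) (p u : E2) : R :=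
  (cd_S _ (D b) (radius p) + cd_s _ (D b) (radius p)) * cross p u.

Lemma chart_coeff (b : bool) t :
  t ^ 2 * (cd_S _ (D b) t + cd_s _ (D b) t) = (if b then 1 else -1) * primitive_coeff (if b then t else l - t).
Proof.
  rewrite Rmult_plus_distr_l, cd_area, cd_slope; apply primitive_coeff_chart.
Qed.

Lemma invariant_primitive_polar b p u : 0 < radius p ->
  invariant_primitive b p u = (if b then 1 else -1) * primitive_coeff (lat l b p) * dtheta p u.
Proof.
  intros Hr; rewrite <- lat_if, <- chart_coeff.
  unfold invariant_primitive, dtheta; fold (cross p u); field; lra.
Qed.

Lemma invariant_primitive_form : sphere_one_form l invariant_primitive.
Proof.
  split.
  - intros b; split.
    + intros p _; eapply is_linear_eq;
        [|apply (is_linear_E2 (invariant_primitive b p (1, 0)) (invariant_primitive b p (0, 1)))].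
      intros u; unfold invariant_primitive, cross; cbn [fst snd]; ring.
    + intros v; apply smooth_restrict; unfold invariant_primitive, cross.
      apply smooth_mult.
      * apply smooth_plus; apply smooth_radial; [apply cd_rS|apply cd_rs].
      * apply smooth_minus; apply smooth_mult;
          first [apply smooth_const|apply smooth_fst_E2|apply smooth_snd_E2].
  - intros b p v Ho.
    rewrite !invariant_primitive_polar; try apply Ho; try (apply overlap_trans, Ho).
    rewrite lat_trans, dtheta_trans by easy; destruct b; simpl; ring.
Qed.

(** Off the pole the S terms give gam / r and the s terms gam'' / r. At the pole [cd_s0] supplies
    g'''(0), which agrees with the limit value chosen in [curvature]. *)
Lemma curvature_chart b p : disc l p ->
  2 * (cd_S _ (D b) (radius p) + cd_s _ (D b) (radius p))
   + radius p ^ 2 * (cd_S1 _ (D b) (radius p) + cd_s1 _ (D b) (radius p))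
  = (1 - curvature gam (lat l b p)) * (1 + radius p ^ 2 * cd_k _ (D b) (radius p)).
Proof.
  intros Hd; unfold disc in Hd; pose proof (radius_pos p).
  assert (D2 : Derive_n (chart_profile l gam b) 2 (radius p) = Derive_n gam 2 (lat l b p))
    by (rewrite Derive_n_chart_profile, lat_if; destruct b; simpl; ring).
  assert (Eg : gam (lat l b p) = radius p + radius p ^ 3 * cd_k _ (D b) (radius p))
    by (rewrite <- gam_chart, lat_if; easy).
  transitivity ((1 + radius p ^ 2 * cd_k _ (D b) (radius p))
    + (2 * cd_s _ (D b) (radius p) + radius p ^ 2 * cd_s1 _ (D b) (radius p)));
    [rewrite <- cd_Sk; ring|].
  pose proof (cd_slope' _ (D b) (radius p)) as Es; rewrite D2 in Es.
  destruct (Req_dec (radius p) 0) as [H0|H0].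
  - rewrite H0 in *. rewrite pow_ne_zero by easy. rewrite !Rmult_0_l, !Rplus_0_r, cd_s0, Derive_n_chart_profile.
    unfold curvature.
    destruct (Req_EM_T (gam (lat l b p)) 0) as [_|Hn]; [|exfalso; apply Hn; rewrite Eg; ring].
    rewrite <- lat_if, H0. destruct b; cbv iota; rewrite ?Rminus_0_r, ?(np_dleft _ _ Hp), ?(np_dright _ _ Hp); field.
  - unfold curvature; destruct (Req_EM_T (gam (lat l b p)) 0) as [Hz|_].
    { pose proof (np_pos _ _ Hp (lat l b p)) as Hpos; rewrite <- lat_if in Hpos, Hz.
      rewrite Hz in Hpos; destruct b; lra. }
    pose proof (chart_nondegenerate b p Hd) as HD.
    rewrite <- Es, Eg.
    replace (radius p + radius p ^ 3 * cd_k _ (D b) (radius p))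
      with (radius p * (1 + radius p ^ 2 * cd_k _ (D b) (radius p))) by ring.
    generalize dependent (1 + radius p ^ 2 * cd_k _ (D b) (radius p)); intros; field; lra.
Qed.

Lemma ext_d_invariant_primitive b p u v : disc l p ->
  ext_d (V := E2) (invariant_primitive b) p u v = (1 - curvature gam (lat l b p)) * area l gam b p u v.
Proof.
  intros Hd; rewrite (area_frame l gam b _ (gam_chart b)), <- Rmult_assoc, <- curvature_chart by easy.
  apply (ext_d_radial_form (fun t => cd_S _ (D b) t + cd_s _ (D b) t) (fun t => cd_S1 _ (D b) t + cd_s1 _ (D b) t)).
  intros t; rewrite Rmult_plus_distr_l.
  apply (is_derive_plus (V := R_NormedModule)); [apply cd_dS|apply cd_ds].
Qed.

Hypothesis bound : forall t, 0 <= t <= l -> Rabs (primitive_coeff t) <= gam t.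

Lemma metric_nonneg b p v : 0 <= metric l gam b p v v.
Proof. rewrite (metric_frame l gam b _ (gam_chart b)); nra. Qed.

Lemma invariant_primitive_bound b p v : disc l p ->
  invariant_primitive b p v ^ 2 <= metric l gam b p v v.
Proof.
  intros Hd; destruct (Rle_lt_or_eq_dec 0 (radius p) (radius_pos p)) as [Hr|Hr].
  - rewrite invariant_primitive_polar by easy.
    unfold metric; destruct (Req_EM_T (radius p) 0); [lra|].
    pose proof (bound _ (disc_lat b p Hd)) as Hb.
    assert (Hb2 : primitive_coeff (lat l b p) ^ 2 <= gam (lat l b p) ^ 2)
      by (rewrite <- !Rsqr_pow2; apply Rsqr_le_abs_1; apply Rle_trans with (1 := Hb), Rle_abs).
    pose proof (pow2_ge_0 (dt p v)). pose proof (pow2_ge_0 (dtheta p v)).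
    replace (((if b then 1 else -1) * primitive_coeff (lat l b p) * dtheta p v) ^ 2)
      with (primitive_coeff (lat l b p) ^ 2 * dtheta p v ^ 2) by (destruct b; ring).
    nra.
  - destruct (radius_0 p (eq_sym Hr)) as [Hx Hy].
    unfold invariant_primitive, cross; rewrite Hx, Hy.
    pose proof (metric_nonneg b p v); nra.
Qed.

(** The infimum [m_gamma] runs over finite norms, so the suprema must be shown finite and not merely
    at most 1. The zero vector and the pole keep them from being minus infinity. *)
Lemma invariant_primitive_norm : exists y, y <= 1 /\ form_norm l gam invariant_primitive = Finite y.
Proof.
  assert (Hc : forall b p, disc l p ->
    0 <= covector_norm l gam b p (invariant_primitive b p) <= 1).
  { intros b p Hd; unfold covector_norm.
    destruct (Lub_Rbar_correct (fun y => exists v, metric l gam b p v v <= 1 /\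
      y = Rabs (invariant_primitive b p v))) as [Hub Hlub].
    assert (H1 : Rbar_le (Lub_Rbar (fun y => exists v, metric l gam b p v v <= 1 /\
      y = Rabs (invariant_primitive b p v))) 1).
    { apply Hlub; intros y [v [Hv ->]]; simpl.
      pose proof (invariant_primitive_bound b p v Hd).
      apply Rabs_le; nra. }
    assert (H0 : Rbar_le 0 (Lub_Rbar (fun y => exists v, metric l gam b p v v <= 1 /\
      y = Rabs (invariant_primitive b p v)))).
    { apply Hub; exists (0, 0); split.
      - rewrite (metric_frame l gam b _ (gam_chart b)); unfold frame1, frame2, twist, cross; simpl; lra.
      - unfold invariant_primitive, cross; simpl; rewrite !Rmult_0_r, Rminus_0_r, Rmult_0_r, Rabs_R0; easy. }
    destruct (Lub_Rbar _); simpl in *; try easy; lra. }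
  unfold form_norm.
  match goal with |- exists y, _ /\ Lub_Rbar ?E = _ => destruct (Lub_Rbar_correct E) as [Hub Hlub]; set (L := Lub_Rbar E) in * end.
  assert (H1 : Rbar_le L 1).
  { apply Hlub; intros y (b & p & Hd & ->); now apply Hc. }
  assert (H0 : Rbar_le 0 L).
  { assert (Hd : disc l (0, 0)).
    { unfold disc, radius; simpl. replace (0 * (0 * 1) + 0 * (0 * 1)) with 0 by ring.
      rewrite sqrt_0; apply (np_length _ _ Hp). }
    apply Rbar_le_trans with (covector_norm l gam true (0, 0) (invariant_primitive true (0, 0))).
    - now apply Hc.
    - apply Hub; now exists true, (0, 0). }
  destruct L as [y| |]; simpl in *; try easy; now exists y.
Qed.

Lemma m_gamma_le_1 : Rbar_le (m_gamma l gam) 1.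
Proof.
  destruct invariant_primitive_norm as [y [Hy E]].
  apply Rbar_le_trans with y; [|easy].
  apply Glb_Rbar_correct; exists invariant_primitive; split; [|split]; auto.
  - apply invariant_primitive_form.
  - intros; now apply ext_d_invariant_primitive.
Qed.

Lemma Derive_chart b t :
  Derive (chart_profile l gam b) t = 1 + 3 * t ^ 2 * cd_k _ (D b) t + t ^ 4 * cd_k1 _ (D b) t.
Proof.
  rewrite (Derive_ext _ _ t (cd_g _ (D b))).
  pose proof (cd_dk _ (D b) t) as H. apply is_derive_unique.
  auto_derive; [eexists; exact H|].
  rewrite (Derive_eta _ _ _ H); ring.
Qed.

Lemma contact_type m : 0 < m -> positive_contact_type l gam m.
Proof.
  intros Hm.
  exists (fun b => magnetic_field (cd_k _ (D b)) (cd_k1 _ (D b))).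
  exists (fun b => contact_form (cd_k _ (D b)) (cd_k1 _ (D b)) (cd_S _ (D b)) m).
  split; [|split; [split|]].
  - intros b q eta Hd.
    apply (magnetic_field_hamiltonian l gam b _ _ (gam_chart b) (cd_dk _ (D b))).
    apply Rgt_not_eq, chart_nondegenerate, Hd.
  - intros b q Hd He.
    exists (Tdisc l), (contact_form (cd_k _ (D b)) (cd_k1 _ (D b)) (cd_S _ (D b)) m).
    split; [|split; [|split; [|split]]]; auto.
    + apply (open_comp (fun q : TE2 => radius (fst q)) (fun r => r < l)); [|apply open_lt].
      intros [p v] _; apply (continuous_comp fst radius); [apply continuous_fst|apply continuous_radius].
    + apply contact_form_one_form; [apply cd_rk|apply cd_rk1|apply cd_rS].
    + intros q' Hd' He'; split; auto. intros xi eta Hxi Heta.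
      apply (contact_form_primitive l gam b _ _ (cd_k2 _ (D b)) (gam_chart b) (cd_dk _ (D b)) (cd_dk1 _ (D b))
        _ (cd_S1 _ (D b)) m Hm (cd_dS _ (D b)) (cd_Sk _ (D b))); easy.
  - intros b q xi Ho He _. destruct q as [p v], xi as [a c]; cbn [fst] in Ho.
    assert (ET : d_Ttrans l (p, v) (a, c) = (d_trans l p a, d2trans l p v a c)).
    { unfold d_Ttrans; f_equal. apply (velocity_d_trans l p v a c), Ho. }
    rewrite ET; unfold Ttrans; cbn [fst snd].
    assert (Hr : 0 < radius p) by apply Ho.
    assert (Hr' : 0 < radius (trans l p)) by apply overlap_trans, Ho.
    rewrite (contact_form_polar l gam b _ _ _ m (p, v) (a, c) (gam_chart b) Hm Hr He).
    rewrite (contact_form_polar l gam (negb b) _ _ _ m (trans l p, d_trans l p v)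
      (d_trans l p a, d2trans l p v a c) (gam_chart (negb b)) Hm Hr').
    2:{ rewrite <- He; unfold energy; cbn [fst snd]; now rewrite metric_trans. }
    cbn [fst snd].
    rewrite metric_trans, !dt_trans, !dtheta_trans, ddt_trans, ddtheta_trans by easy.
    rewrite radius_trans by easy.
    (* The total integral 2 enters here: 1 - int g changes sign between the charts, like dtheta, so
       their product is unchanged. *)
    rewrite <- !cd_g, <- !Derive_chart, !cd_area, area_chart_profile.
    rewrite chart_profile_negb, Derive_chart_profile_negb.
    generalize (RInt (chart_profile l gam b) 0 (radius p) : R); intros I.
    field; lra.
  - intros b q Hd He; destruct q as [p v].
    pose proof (chart_nondegenerate b p Hd) as HD.
    rewrite (contact_form_field l gam b _ _ (gam_chart b) _ m Hm (p, v) He)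
      by (apply Rgt_not_eq, HD).
    cbn [fst snd].
    (* The connection contributes (gam' - 1) dtheta and the area primitive int g dtheta: together
       they are B dtheta, up to the orientation of the chart. *)
    assert (E : conn (cd_k _ (D b)) (cd_k1 _ (D b)) p v + cd_S _ (D b) (radius p) * cross p v
       = invariant_primitive b p v).
    { unfold conn, invariant_primitive.
      destruct (Req_dec (radius p) 0) as [H0|H0].
      - destruct (radius_0 p H0) as [Hx Hy]; unfold cross; rewrite Hx, Hy; ring.
      - replace (cd_s _ (D b) (radius p)) with
          (3 * cd_k _ (D b) (radius p) + radius p ^ 2 * cd_k1 _ (D b) (radius p)); [ring|].
        apply (Rmult_eq_reg_l (radius p ^ 2)); [|now apply pow_nonzero].
        rewrite cd_slope, Derive_chart; ring. }
    (* On the level |v| = m, so this bounds the last term by m; m^2 - m + 1 has negative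
       discriminant, hence positivity for every m. *)
    pose proof (invariant_primitive_bound b p v Hd) as Hb.
    unfold energy in He; cbn [fst snd] in He.
    nra.
Qed.

End Data.
End Profile.

(** * Symmetric profiles with increasing curvature *)

Lemma mean_value (f df : R -> R) a b :
  (forall x, is_derive f x (df x)) -> a <= b ->
  exists c, a <= c <= b /\ f b - f a = df c * (b - a).
Proof.
  intros Hd Hab.
  destruct (MVT_gen f a b df) as [c [Hc E]].
  - intros; apply Hd.
  - intros x _. apply continuity_pt_filterlim.
    apply (ex_derive_continuous (V := R_NormedModule)); eexists; apply Hd.
  - rewrite Rmin_left, Rmax_right in Hc by easy; now exists c.
Qed.

Section Symmetric.
Variables (l : R) (gam : R -> R).
Hypothesis Hp : normalised_profile l gam.
Hypothesis sym : forall t, 0 <= t <= l -> gam t = gam (l - t).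
Hypothesis mono : forall s t, 0 <= s -> s <= t -> t <= l / 2 ->
  curvature gam s <= curvature gam t.

Let B := primitive_coeff gam.
Let G : R -> R := RInt gam 0.
Let g1 := Derive gam.
Let g2 := Derive_n gam 2.

Lemma d_gam t : is_derive gam t (g1 t).
Proof. apply smooth_is_derive, (profile_smooth l), Hp. Qed.

Lemma d_g1 t : is_derive g1 t (g2 t).
Proof. apply (smooth_is_derive g1), smooth_Derive, (profile_smooth l), Hp. Qed.

Lemma d_G t : is_derive G t (gam t).
Proof. apply smooth_primitive, (profile_smooth l), Hp. Qed.

Lemma d_B t : is_derive B t (gam t + g2 t).
Proof.
  evar_last.
  - apply (is_derive_plus (V := R_NormedModule) (fun t => G t - 1) g1).
    + apply (is_derive_minus (V := R_NormedModule) G (fun _ => 1)); [apply d_G|].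
      apply (is_derive_const (V := R_NormedModule)).
    + apply d_g1.
  - change (gam t - 0 + g2 t = gam t + g2 t); ring.
Qed.

Lemma area_antisym t : 0 <= t <= l -> G (l - t) = 2 - G t.
Proof.
  intros Ht. pose proof (area_chart_profile l gam Hp false t) as E.
  unfold G; change (RInt gam 0 (l - t) = 2 - RInt (chart_profile l gam false) 0 t) in E.
  rewrite E; apply (f_equal (fun x : R => 2 - x)), RInt_ext.
  rewrite Rmin_left, Rmax_right by lra; intros x Hx. symmetry; apply sym; lra.
Qed.

Lemma slope_antisym t : 0 <= t <= l -> g1 (l - t) = - g1 t.
Proof.
  intros [H0 Hl]; unfold g1.
  (* Symmetry is known on [0, l] only and can be differentiated inside it; at the endpoints the
     prescribed slopes are used. *)
  destruct (Rle_lt_or_eq_dec _ _ H0) as [H0'| <-];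
    [|rewrite Rminus_0_r, (np_dleft _ _ Hp), (np_dright _ _ Hp); ring].
  destruct (Rle_lt_or_eq_dec _ _ Hl) as [Hl'| ->];
    [|rewrite Rminus_diag, (np_dleft _ _ Hp), (np_dright _ _ Hp); ring].
  assert (E : Derive (chart_profile l gam false) t = Derive gam t).
  { apply Derive_ext_loc.
    assert (L : locally t (fun x => 0 < x < l))
      by (apply (open_and (fun x => 0 < x) (fun x => x < l)); [apply open_gt|apply open_lt|easy]).
    generalize L; apply filter_imp; intros x Hx; symmetry; apply sym; lra. }
  rewrite (Derive_chart_profile l gam Hp false t) in E. cbv iota in E. lra.
Qed.

Lemma primitive_coeff_antisym t : 0 <= t <= l -> B (l - t) = - B t.
Proof.
  intros Ht; unfold B, primitive_coeff.
  pose proof (area_antisym t Ht) as E1; pose proof (slope_antisym t Ht) as E2.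
  unfold G in E1; unfold g1 in E2; rewrite E1, E2; ring.
Qed.

Lemma gam_second t : 0 < t < l -> g2 t = - curvature gam t * gam t.
Proof.
  intros Ht; pose proof (np_pos _ _ Hp t Ht); unfold curvature, g2.
  destruct (Req_EM_T (gam t) 0); [lra|field; lra].
Qed.

Lemma gam_nonneg t : 0 <= t <= l -> 0 <= gam t.
Proof.
  intros [H0 Hl].
  destruct (Rle_lt_or_eq_dec _ _ H0) as [H0'| <-]; [|rewrite (np_left _ _ Hp); lra].
  destruct (Rle_lt_or_eq_dec _ _ Hl) as [Hl'| ->]; [|rewrite (np_right _ _ Hp); lra].
  apply Rlt_le, (np_pos _ _ Hp); easy.
Qed.

Lemma g2_0 : g2 0 = 0.
Proof. apply (np_even _ _ Hp 1%nat). Qed.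

(** A negative value at t forces K < 0 on all of (0, t] by monotonicity. Then gam'' >= 0 there and
    gam' does not fall below its initial value 1, against |gam'| < 1. *)
Lemma curvature_nonneg t : 0 < t <= l / 2 -> 0 <= curvature gam t.
Proof.
  intros Ht; destruct (Rle_or_lt 0 (curvature gam t)) as [|Hneg]; [easy|exfalso].
  destruct (mean_value g1 g2 0 t d_g1) as [c [Hc E]]; [lra|].
  assert (0 <= g2 c).
  { destruct (Rle_lt_or_eq_dec 0 c) as [Hc0| <-]; [lra| |rewrite g2_0; lra].
    rewrite gam_second by lra. pose proof (mono c t). pose proof (np_pos _ _ Hp c). nra. }
  pose proof (np_dlt1 _ _ Hp t) as H1. pose proof (Rle_abs (g1 t)).
  pose proof (np_dleft _ _ Hp) as H2. fold g1 in H1, H2. nra.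
Qed.

Lemma half : 0 < l / 2 < l.
Proof. pose proof (np_length _ _ Hp); lra. Qed.

Lemma primitive_coeff_0 : B 0 = 0.
Proof.
  unfold B, primitive_coeff; rewrite (np_dleft _ _ Hp), RInt_point.
  change (0 - 1 + 1 = 0); ring.
Qed.

Lemma primitive_coeff_half : B (l / 2) = 0.
Proof.
  pose proof half. pose proof (primitive_coeff_antisym (l / 2)) as E.
  replace (l - l / 2) with (l / 2) in E by field. lra.
Qed.

(** B vanishes at 0 and at l / 2. A negative value in between would make B' = (1 - K) gam negative
    at some c and positive at a later c', so K > 1 at c and K < 1 at c', against monotonicity. *)
Lemma primitive_coeff_nonneg t : 0 <= t <= l / 2 -> 0 <= B t.
Proof.
  intros Ht; pose proof half.
  destruct (Rle_or_lt 0 (B t)) as [|Hneg]; [easy|exfalso].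
  destruct (mean_value B _ 0 t d_B) as [c [Hc E]]; [lra|].
  destruct (mean_value B _ t (l / 2) d_B) as [c' [Hc' E']]; [lra|].
  rewrite primitive_coeff_0 in E; rewrite primitive_coeff_half in E'.
  assert (D : gam c + g2 c < 0) by nra.
  assert (D' : 0 < gam c' + g2 c') by nra.
  assert (Hc0 : c <> 0) by (intros ->; rewrite g2_0, (np_left _ _ Hp) in D; lra).
  rewrite gam_second in D by lra. rewrite gam_second in D' by lra.
  pose proof (np_pos _ _ Hp c). pose proof (np_pos _ _ Hp c').
  assert (curvature gam c <= curvature gam c') by (apply mono; lra).
  assert (1 < curvature gam c) by nra.
  nra.
Qed.

(* Since B <= gam' and B' <= gam with B >= 0, the function gam^2 - B^2 increases. *)
Lemma primitive_coeff_le t : 0 <= t <= l / 2 -> Rabs (B t) <= gam t.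
Proof.
  intros Ht; pose proof half.
  assert (D : forall x, is_derive (fun x => gam x ^ 2 - B x ^ 2) x
    (2 * (gam x * g1 x - B x * (gam x + g2 x)))).
  { intros x; pose proof (d_gam x) as H1; pose proof (d_B x) as H2.
    auto_derive; [split; [eexists; exact H1|split; [eexists; exact H2|easy]]|].
    rewrite (Derive_eta gam _ _ H1), (Derive_eta B _ _ H2); ring. }
  destruct (mean_value _ _ 0 t D) as [c [Hc E]]; [lra|].
  rewrite primitive_coeff_0, (np_left _ _ Hp) in E.
  assert (HB : 0 <= B c) by (apply primitive_coeff_nonneg; lra).
  (* By symmetry the integral up to the equator is 1, and gam >= 0. *)
  assert (HG : G c <= 1).
  { destruct (mean_value G _ c (l / 2) d_G) as [c' [Hc' E']]; [lra|].
    pose proof (area_antisym (l / 2)) as Eh. replace (l - l / 2) with (l / 2) in Eh by field.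
    pose proof (gam_nonneg c'). nra. }
  assert (Hle : B c <= g1 c) by (unfold B, primitive_coeff; fold (G c) (g1 c); lra).
  assert (Hg : 0 <= gam c) by (apply gam_nonneg; lra).
  assert (HB' : gam c + g2 c <= gam c).
  { destruct (Rle_lt_or_eq_dec 0 c) as [Hc0| <-]; [lra| |rewrite g2_0; lra].
    rewrite gam_second by lra. pose proof (curvature_nonneg c). nra. }
  assert (0 <= gam t ^ 2 - B t ^ 2).
  { replace (gam t ^ 2 - B t ^ 2) with (2 * (gam c * g1 c - B c * (gam c + g2 c)) * t) by lra.
    apply Rmult_le_pos; [|lra]. nra. }
  assert (0 <= gam t) by (apply gam_nonneg; lra).
  assert (0 <= B t) by now apply primitive_coeff_nonneg.
  rewrite Rabs_pos_eq by easy. nra.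
Qed.

Lemma primitive_coeff_bound t : 0 <= t <= l -> Rabs (B t) <= gam t.
Proof.
  intros Ht; destruct (Rle_or_lt t (l / 2)); [now apply primitive_coeff_le|].
  rewrite sym, <- (Rabs_Ropp (B t)), <- primitive_coeff_antisym by easy.
  apply primitive_coeff_le; lra.
Qed.

End Symmetric.

(** * Stokes on a parallel and the lower bound for m_gamma *)

Lemma open_disc l : open (disc l).
Proof.
  apply (open_comp radius (fun r => r < l)); [|apply open_lt].
  intros p _; apply continuous_radius.
Qed.

Lemma is_derive_slice1 (f : E2 -> R) x y d :
  is_dirD (V := E2) f (1, 0) (x, y) d -> is_derive (fun z => f (z, y)) x d.
Proof.
  intros H. change (is_derive (fun s => f (x + s * 1, y + s * 0)) 0 d) in H.
  apply (is_derive_ext (fun z => (fun s => f (x + s * 1, y + s * 0)) (z - x))).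
  { intros z; simpl; do 2 f_equal; ring. }
  replace d with (1 * d) by ring.
  apply (is_derive_comp (V := R_NormedModule) (fun s => f (x + s * 1, y + s * 0)) (fun z => z - x)).
  - now rewrite Rminus_diag.
  - auto_derive; easy.
Qed.

Lemma is_derive_slice2 (f : E2 -> R) x y d :
  is_dirD (V := E2) f (0, 1) (x, y) d -> is_derive (fun z => f (x, z)) y d.
Proof.
  intros H. change (is_derive (fun s => f (x + s * 0, y + s * 1)) 0 d) in H.
  apply (is_derive_ext (fun z => (fun s => f (x + s * 0, y + s * 1)) (z - y))).
  { intros z; simpl; do 2 f_equal; ring. }
  replace d with (1 * d) by ring.
  apply (is_derive_comp (V := R_NormedModule) (fun s => f (x + s * 0, y + s * 1)) (fun z => z - y)).
  - now rewrite Rminus_diag.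
  - auto_derive; easy.
Qed.

(** [smooth_on] speaks of derivatives along lines only. Continuity of the partial derivatives gives
    total differentiability, and with it the chain rule along curves. *)
Lemma is_derive_curve (U : E2 -> Prop) (f : E2 -> R) (x y : R -> R) t x' y' :
  open U -> smooth_on U f -> U (x t, y t) ->
  is_derive x t x' -> is_derive y t y' ->
  is_derive (fun s => f (x s, y s)) t
    (x' * dirD f (1, 0) (x t, y t) + y' * dirD f (0, 1) (x t, y t)).
Proof.
  intros Uo Hf HU Hx Hy.
  pose proof (filterdiff_comp'_2 x y (fun u v => f (u, v)) t (fun h => scal h x') (fun h => scal h y')
    (fun u v => plus (scal u (dirD f (1, 0) (x t, y t))) (scal v (dirD f (0, 1) (x t, y t)))) Hx Hy) as H.
  unfold is_derive. eapply filterdiff_ext_lin; [apply H|].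
  - apply (is_derive_filterdiff (fun u v => f (u, v)) (x t) (y t) (fun u v => dirD f (1, 0) (u, v))).
    + generalize (Uo _ HU); apply filter_imp; intros [u v] Huv; simpl.
      apply is_derive_slice1. now apply (smooth_on_is_dirD U).
    + apply is_derive_slice2. now apply (smooth_on_is_dirD U).
    + apply (continuous_ext (dirD f (1, 0))); [now intros [u v]|].
      apply (smooth_on_continuous U); [now apply smooth_on_dirD|easy].
  - intros h; simpl. unfold plus, scal; simpl; unfold mult; simpl; ring.
Qed.

Lemma continuity_2d_continuous (f : R -> R -> R) x y : continuity_2d_pt f x y -> continuous (f x) y.
Proof.
  intros H; apply (continuous_comp_2 (fun _ => x) (fun y => y) f).
  - apply continuous_const.
  - apply continuous_id.
  - now apply continuity_2d_pt_filterlim.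
Qed.

Section Stokes.
Variables (l : R) (a : E2 -> E2 -> R).
Hypothesis Ha : one_form_on (disc l) a.

Definition on_circle (t th : R) : E2 := (t * cos th, t * sin th).

Lemma radius_on_circle t th : radius (on_circle t th) = Rabs t.
Proof.
  unfold radius, on_circle; simpl fst; simpl snd.
  replace ((t * cos th) ^ 2 + (t * sin th) ^ 2) with (Rsqr t).
  - apply sqrt_Rsqr_abs.
  - pose proof (sin2_cos2 th) as E; unfold Rsqr in *.
    transitivity (t * t * (sin th * sin th + cos th * cos th)); [rewrite E|]; ring.
Qed.

Lemma disc_on_circle t th : Rabs t < l -> disc l (on_circle t th).
Proof. intros H; unfold disc; now rewrite radius_on_circle. Qed.

Lemma continuity_on_circle (f : E2 -> R) t th :
  smooth_on (disc l) f -> Rabs t < l -> continuity_2d_pt (fun t th => f (on_circle t th)) t th.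
Proof.
  intros Hf Ht; apply continuity_2d_pt_filterlim.
  assert (C1 : continuity_2d_pt (fun t th => t * cos th) t th).
  { apply continuity_2d_pt_mult; [apply continuity_2d_pt_id1|].
    apply (continuity_1d_2d_pt_comp cos (fun _ th => th)); [apply continuity_cos|apply continuity_2d_pt_id2]. }
  assert (C2 : continuity_2d_pt (fun t th => t * sin th) t th).
  { apply continuity_2d_pt_mult; [apply continuity_2d_pt_id1|].
    apply (continuity_1d_2d_pt_comp sin (fun _ th => th)); [apply continuity_sin|apply continuity_2d_pt_id2]. }
  apply continuity_2d_pt_filterlim in C1; apply continuity_2d_pt_filterlim in C2.
  apply (continuous_comp_2 (fun z : R * R => fst z * cos (snd z)) (fun z : R * R => fst z * sin (snd z))
    (fun x y => f (x, y)) (t, th) C1 C2).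
  apply (continuous_ext f); [now intros [u v]|].
  apply (smooth_on_continuous (disc l)); [easy|]. now apply disc_on_circle.
Qed.

Let P (p : E2) := a p (1, 0).
Let Q (p : E2) := a p (0, 1).

Lemma smooth_P : smooth_on (disc l) P. Proof. apply Ha. Qed.
Lemma smooth_Q : smooth_on (disc l) Q. Proof. apply Ha. Qed.

Lemma one_form_components p u : disc l p -> a p u = fst u * P p + snd u * Q p.
Proof.
  intros Hp; destruct (proj1 Ha p Hp) as [Hadd Hscal _]; destruct u as [u1 u2]; simpl.
  pose proof (Hadd (scal u1 ((1, 0) : E2)) (scal u2 ((0, 1) : E2))) as E.
  rewrite (Hscal u1), (Hscal u2) in E.
  refine (eq_trans _ E); f_equal.
  change ((u1, u2) = (u1 * 1 + u2 * 0, u1 * 0 + u2 * 1)).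
  now rewrite !Rmult_1_r, !Rmult_0_r, Rplus_0_r, Rplus_0_l.
Qed.

(** The value of the form on d/dtheta. The formula also covers negative t, which makes t = 0 an
    interior point and gives continuity of the circulation there. *)
Definition circulation_density (t th : R) : R :=
  t * (- sin th * P (on_circle t th) + cos th * Q (on_circle t th)).
Definition circulation (t : R) : R := RInt (circulation_density t) 0 (2 * PI).

Let radial_part (t th : R) : R := cos th * P (on_circle t th) + sin th * Q (on_circle t th).

Let d_density (t th : R) : R :=
  (- sin th * P (on_circle t th) + cos th * Q (on_circle t th))
  + t * (- sin th * (cos th * dirD P (1, 0) (on_circle t th) + sin th * dirD P (0, 1) (on_circle t th))
         + cos th * (cos th * dirD Q (1, 0) (on_circle t th) + sin th * dirD Q (0, 1) (on_circle t th))).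

Let d_radial_part (t th : R) : R :=
  (- sin th * P (on_circle t th) + cos th * Q (on_circle t th))
  + (cos th * (- (t * sin th) * dirD P (1, 0) (on_circle t th) + t * cos th * dirD P (0, 1) (on_circle t th))
     + sin th * (- (t * sin th) * dirD Q (1, 0) (on_circle t th) + t * cos th * dirD Q (0, 1) (on_circle t th))).

Lemma is_derive_ray (f : E2 -> R) t th : smooth_on (disc l) f -> Rabs t < l ->
  is_derive (fun t => f (on_circle t th)) t
    (cos th * dirD f (1, 0) (on_circle t th) + sin th * dirD f (0, 1) (on_circle t th)).
Proof.
  intros Hf Ht.
  apply (is_derive_curve (disc l) f (fun t => t * cos th) (fun t => t * sin th)).
  - apply open_disc.
  - easy.
  - now apply disc_on_circle.
  - auto_derive; [easy|ring].
  - auto_derive; [easy|ring].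
Qed.

Lemma is_derive_circle (f : E2 -> R) t th : smooth_on (disc l) f -> Rabs t < l ->
  is_derive (fun th => f (on_circle t th)) th
    (- (t * sin th) * dirD f (1, 0) (on_circle t th) + t * cos th * dirD f (0, 1) (on_circle t th)).
Proof.
  intros Hf Ht.
  apply (is_derive_curve (disc l) f (fun th => t * cos th) (fun th => t * sin th)).
  - apply open_disc.
  - easy.
  - now apply disc_on_circle.
  - auto_derive; [easy|ring].
  - auto_derive; [easy|ring].
Qed.

Lemma is_derive_density t th : Rabs t < l ->
  is_derive (fun t => circulation_density t th) t (d_density t th).
Proof.
  intros Ht.
  pose proof (is_derive_ray P t th smooth_P Ht) as HP.
  pose proof (is_derive_ray Q t th smooth_Q Ht) as HQ.
  unfold circulation_density, d_density.
  set (p := fun t => P (on_circle t th)) in *. set (q := fun t => Q (on_circle t th)) in *.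
  change (is_derive (fun t => t * (- sin th * p t + cos th * q t)) t
   ((- sin th * p t + cos th * q t)
  + t * (- sin th * (cos th * dirD P (1, 0) (on_circle t th) + sin th * dirD P (0, 1) (on_circle t th))
         + cos th * (cos th * dirD Q (1, 0) (on_circle t th) + sin th * dirD Q (0, 1) (on_circle t th))))).
  change (is_derive p t (cos th * dirD P (1, 0) (on_circle t th) + sin th * dirD P (0, 1) (on_circle t th))) in HP.
  change (is_derive q t (cos th * dirD Q (1, 0) (on_circle t th) + sin th * dirD Q (0, 1) (on_circle t th))) in HQ.
  clearbody p q.
  auto_derive; [split; [eexists; exact HP|split; [eexists; exact HQ|easy]]|].
  rewrite (Derive_eta p _ _ HP), (Derive_eta q _ _ HQ); ring.
Qed.

Lemma is_derive_radial_part t th : Rabs t < l ->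
  is_derive (radial_part t) th (d_radial_part t th).
Proof.
  intros Ht.
  pose proof (is_derive_circle P t th smooth_P Ht) as HP.
  pose proof (is_derive_circle Q t th smooth_Q Ht) as HQ.
  unfold d_radial_part.
  set (p := fun th => P (on_circle t th)) in *. set (q := fun th => Q (on_circle t th)) in *.
  change (is_derive (fun th => cos th * p th + sin th * q th) th
   ((- sin th * p th + cos th * q th)
  + (cos th * (- (t * sin th) * dirD P (1, 0) (on_circle t th) + t * cos th * dirD P (0, 1) (on_circle t th))
     + sin th * (- (t * sin th) * dirD Q (1, 0) (on_circle t th) + t * cos th * dirD Q (0, 1) (on_circle t th))))).
  change (is_derive p th (- (t * sin th) * dirD P (1, 0) (on_circle t th) + t * cos th * dirD P (0, 1) (on_circle t th))) in HP.
  change (is_derive q th (- (t * sin th) * dirD Q (1, 0) (on_circle t th) + t * cos th * dirD Q (0, 1) (on_circle t th))) in HQ.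
  clearbody p q.
  auto_derive; [split; [eexists; exact HP|split; [eexists; exact HQ|easy]]|].
  rewrite (Derive_eta p _ _ HP), (Derive_eta q _ _ HQ); ring.
Qed.

Lemma continuity_sin_2d t th : continuity_2d_pt (fun _ th => sin th) t th.
Proof. apply (continuity_1d_2d_pt_comp sin (fun _ th => th)); [apply continuity_sin|apply continuity_2d_pt_id2]. Qed.

Lemma continuity_cos_2d t th : continuity_2d_pt (fun _ th => cos th) t th.
Proof. apply (continuity_1d_2d_pt_comp cos (fun _ th => th)); [apply continuity_cos|apply continuity_2d_pt_id2]. Qed.

Ltac continuity_2d :=
  repeat first
    [ assumption | apply continuity_sin_2d | apply continuity_cos_2d | apply continuity_2d_pt_id1
    | apply continuity_2d_pt_plus | apply continuity_2d_pt_mult | apply continuity_2d_pt_opp ].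

Lemma continuity_density t th : Rabs t < l -> continuity_2d_pt circulation_density t th.
Proof.
  intros Ht; unfold circulation_density.
  pose proof (continuity_on_circle P t th smooth_P Ht) as CP.
  pose proof (continuity_on_circle Q t th smooth_Q Ht) as CQ.
  continuity_2d.
Qed.

Lemma continuity_d_density t th : Rabs t < l -> continuity_2d_pt d_density t th.
Proof.
  intros Ht.
  generalize (continuity_on_circle P t th smooth_P Ht), (continuity_on_circle Q t th smooth_Q Ht).
  generalize (continuity_on_circle _ t th (smooth_on_dirD _ _ (1, 0) smooth_P) Ht).
  generalize (continuity_on_circle _ t th (smooth_on_dirD _ _ (0, 1) smooth_P) Ht).
  generalize (continuity_on_circle _ t th (smooth_on_dirD _ _ (1, 0) smooth_Q) Ht).
  generalize (continuity_on_circle _ t th (smooth_on_dirD _ _ (0, 1) smooth_Q) Ht).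
  unfold d_density; generalize (dirD P (1, 0)) (dirD P (0, 1)) (dirD Q (1, 0)) (dirD Q (0, 1)) P Q.
  intros; continuity_2d.
Qed.

Lemma continuity_d_radial_part t th : Rabs t < l -> continuity_2d_pt d_radial_part t th.
Proof.
  intros Ht.
  generalize (continuity_on_circle P t th smooth_P Ht), (continuity_on_circle Q t th smooth_Q Ht).
  generalize (continuity_on_circle _ t th (smooth_on_dirD _ _ (1, 0) smooth_P) Ht).
  generalize (continuity_on_circle _ t th (smooth_on_dirD _ _ (0, 1) smooth_P) Ht).
  generalize (continuity_on_circle _ t th (smooth_on_dirD _ _ (1, 0) smooth_Q) Ht).
  generalize (continuity_on_circle _ t th (smooth_on_dirD _ _ (0, 1) smooth_Q) Ht).
  unfold d_radial_part; generalize (dirD P (1, 0)) (dirD P (0, 1)) (dirD Q (1, 0)) (dirD Q (0, 1)) P Q.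
  intros; continuity_2d.
Qed.

Lemma locally_abs_lt t : Rabs t < l -> locally t (fun s => Rabs s < l).
Proof. intros Ht; apply (continuous_Rabs t (fun u => u < l)); now apply open_lt. Qed.

Lemma is_derive_circulation t : Rabs t < l ->
  is_derive circulation t (RInt (d_density t) 0 (2 * PI)).
Proof.
  intros Ht; pose proof (locally_abs_lt t Ht) as Hl.
  rewrite (RInt_ext _ (fun th => Derive (fun u => circulation_density u th) t)).
  2:{ intros th _; symmetry; apply is_derive_unique; now apply is_derive_density. }
  apply (is_derive_RInt_param circulation_density).
  - generalize Hl; apply filter_imp; intros s Hs th _; eexists; now apply is_derive_density.
  - intros th _. apply (continuity_2d_pt_ext_loc d_density).
    + destruct Hl as [eps He]; exists eps; intros u v Hu _.
      symmetry; apply is_derive_unique, is_derive_density, He, Hu.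
    + now apply continuity_d_density.
  - generalize Hl; apply filter_imp; intros s Hs.
    apply (ex_RInt_continuous (V := R_CompleteNormedModule)); intros th _.
    now apply continuity_2d_continuous, continuity_density.
Qed.

(* The two derivatives differ by t times the curl, and the angular one integrates to 0. *)
Lemma circulation_derivative t c : Rabs t < l ->
  (forall th, t * ext_d (V := E2) a (on_circle t th) (1, 0) (0, 1) = c) ->
  is_derive circulation t (2 * PI * c).
Proof.
  intros Ht Hc; evar_last; [now apply is_derive_circulation|].
  assert (HI : is_RInt (d_radial_part t) 0 (2 * PI) 0).
  { assert (E0 : radial_part t (2 * PI) - radial_part t 0 = 0).
    { unfold radial_part, on_circle. rewrite cos_2PI, sin_2PI, cos_0, sin_0; ring. }
    evar_last; [|exact E0].
    apply (is_RInt_derive (V := R_CompleteNormedModule) (radial_part t)).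
    - intros; now apply is_derive_radial_part.
    - intros; now apply continuity_2d_continuous, continuity_d_radial_part. }
  assert (E : forall th, d_radial_part t th + c = d_density t th).
  { intros th; rewrite <- (Hc th); unfold ext_d.
    change (fun q : E2 => a q (0, 1)) with Q. change (fun q : E2 => a q (1, 0)) with P.
    unfold d_density, d_radial_part.
    pose proof (sin2_cos2 th) as E; unfold Rsqr in E.
    set (A := dirD Q (1, 0) (on_circle t th)); set (A' := dirD P (0, 1) (on_circle t th)).
    replace (t * (A - A')) with (t * (sin th * sin th + cos th * cos th) * (A - A')) by (rewrite E; ring).
    ring. }
  apply is_RInt_unique, (is_RInt_ext (fun th => d_radial_part t th + c)).
  - intros th _; apply E.
  - replace (2 * PI * c) with (plus 0 (scal (2 * PI - 0) c)).
    + apply (is_RInt_plus (V := R_NormedModule)); [exact HI|].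
      apply (is_RInt_const (V := R_NormedModule)).
    + unfold plus, scal; simpl; unfold mult; simpl; ring.
Qed.

Lemma circulation_bound t M : 0 <= t < l ->
  (forall th, Rabs (circulation_density t th) <= M) -> Rabs (circulation t) <= 2 * PI * M.
Proof.
  intros Ht HM; pose proof PI_RGT_0.
  replace (2 * PI * M) with ((2 * PI - 0) * M) by ring.
  apply abs_RInt_le_const; [lra| |auto].
  apply (ex_RInt_continuous (V := R_CompleteNormedModule)); intros th _.
  apply continuity_2d_continuous, continuity_density. rewrite Rabs_pos_eq; lra.
Qed.

End Stokes.

(** [covector_norm] takes the real part of a supremum, which would be 0 if the supremum were
    infinite. The values of f on the radial and angular directions bound it. *)
Lemma covector_norm_ge l gam b p (f : E2 -> R) v :
  is_linear (V := R_NormedModule) f -> 0 < radius p -> 0 < gam (lat l b p) ->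
  metric l gam b p v v <= 1 -> Rabs (f v) <= covector_norm l gam b p f.
Proof.
  intros [Hadd Hscal _] Hr Hg Hv; unfold covector_norm.
  set (E := fun y => exists v, metric l gam b p v v <= 1 /\ y = Rabs (f v)).
  destruct (Lub_Rbar_correct E) as [Hub Hlub].
  assert (H0 : Rbar_le (Rabs (f v)) (Lub_Rbar E)) by (apply Hub; now exists v).
  assert (H1 : Rbar_le (Lub_Rbar E)
    (Rabs (f (scal (/ radius p) p)) + Rabs (f (- snd p, fst p)) / gam (lat l b p))).
  { apply Hlub; intros y [u [Hu ->]]; simpl.
    unfold metric in Hu; destruct (Req_EM_T (radius p) 0); [lra|].
    assert (Eu : u = plus (scal (dt p u) (scal (/ radius p) p)) (scal (dtheta p u) ((- snd p, fst p) : E2))).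
    { assert (F1 : fst u = dt p u * (/ radius p * fst p) + dtheta p u * - snd p).
      { apply (Rmult_eq_reg_r (radius p ^ 2)); [|apply pow_nonzero; lra].
        transitivity (dot p u * fst p - cross p u * snd p);
          [rewrite radius_sqr; unfold dot, cross; ring|].
        unfold dt, dtheta; fold (dot p u) (cross p u); field; lra. }
      assert (F2 : snd u = dt p u * (/ radius p * snd p) + dtheta p u * fst p).
      { apply (Rmult_eq_reg_r (radius p ^ 2)); [|apply pow_nonzero; lra].
        transitivity (dot p u * snd p + cross p u * fst p);
          [rewrite radius_sqr; unfold dot, cross; ring|].
        unfold dt, dtheta; fold (dot p u) (cross p u); field; lra. }
      apply injective_projections; [exact F1|exact F2]. }
    assert (Ef : f u = dt p u * f (scal (/ radius p) p) + dtheta p u * f (- snd p, fst p)).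
    { rewrite Eu at 1. rewrite Hadd, !Hscal. reflexivity. }
    set (g := gam (lat l b p)) in *.
    assert (A1 : Rabs (dt p u) <= 1).
    { apply Rabs_le. pose proof (pow2_ge_0 (g * dtheta p u)). nra. }
    assert (A2 : Rabs (dtheta p u) <= / g).
    { apply (Rmult_le_reg_l g); [easy|]. rewrite Rinv_r by lra.
      rewrite <- (Rabs_pos_eq g) at 1 by lra. rewrite <- Rabs_mult.
      apply Rabs_le. pose proof (pow2_ge_0 (dt p u)).
      assert ((g * dtheta p u) * (g * dtheta p u) <= 1) by nra. split; nra. }
    rewrite Ef. eapply Rle_trans; [apply Rabs_triang|]. rewrite !Rabs_mult.
    pose proof (Rabs_pos (f (scal (/ radius p) p))). pose proof (Rabs_pos (f (- snd p, fst p))).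
    apply Rplus_le_compat; [nra|].
    rewrite Rmult_comm; now apply Rmult_le_compat_l. }
  destruct (Lub_Rbar E); simpl in *; easy.
Qed.

Section LowerBound.
Variables (l : R) (gam : R -> R).
Hypothesis Hp : normalised_profile l gam.

Lemma m_gamma_ge t : 0 < t < l ->
  Rbar_le (Rabs (primitive_coeff gam t) / gam t) (m_gamma l gam).
Proof.
  intros Ht; apply Glb_Rbar_correct; intros y (beta & [Hb _] & Hd & Hn); simpl.
  pose proof (np_pos _ _ Hp t Ht) as Hg.
  assert (Ha := Hb true); set (a := beta true) in *.
  destruct (chart_data_profile l gam Hp true) as [D _].
  assert (HD : forall s, gam (if true then s else l - s) = s + s ^ 3 * cd_k _ D s) by exact (cd_g _ D).
  assert (HI : circulation a t = 2 * PI * primitive_coeff gam t).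
  (* Both terms have derivative 2 pi (1 - K) gam for s > 0 and vanish at the pole, where continuity
     suffices. *)
  { pose (F := fun s => circulation a s - 2 * PI * primitive_coeff gam s).
    assert (Dc : forall s, 0 < s < l -> is_derive (circulation a) s
       (2 * PI * (gam s + Derive_n gam 2 s))).
    { intros s Hs; apply (circulation_derivative l a Ha); [rewrite Rabs_pos_eq; lra|].
      intros th. unfold a; rewrite Hd by (apply disc_on_circle; rewrite Rabs_pos_eq; lra).
      rewrite (area_frame l gam true _ HD). unfold lat.
      rewrite radius_on_circle, Rabs_pos_eq by lra.
      transitivity ((1 - curvature gam s) * gam s * cross (1, 0) (0, 1)); [rewrite (HD s); ring|].
      rewrite (gam_second l gam Hp s Hs). unfold cross; simpl; ring. }
    destruct (MVT_gen F 0 t (fun _ => 0)) as [c [_ E]].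
    - rewrite Rmin_left, Rmax_right by lra; intros s Hs; evar_last.
      + apply (is_derive_minus (V := R_NormedModule)); [apply Dc; lra|].
        apply is_derive_scal, (d_B l gam Hp).
      + unfold minus, plus, opp; simpl; ring.
    - rewrite Rmin_left, Rmax_right by lra; intros s Hs.
      apply continuity_pt_filterlim, (ex_derive_continuous (V := R_NormedModule)).
      apply (ex_derive_minus (V := R_NormedModule)).
      + eexists; apply (is_derive_circulation l a Ha). rewrite Rabs_pos_eq; lra.
      + eexists; apply is_derive_scal, (d_B l gam Hp).
    - unfold F in E. rewrite (primitive_coeff_0 l gam Hp) in E.
      assert (E0 : circulation a 0 = 0).
      { assert (Z : forall th, circulation_density a 0 th = 0)
          by (intros; unfold circulation_density; ring).
        unfold circulation; rewrite (RInt_ext _ (fun _ => 0)) by (intros; apply Z).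
        rewrite RInt_const; apply Rmult_0_r. }
      rewrite E0 in E. lra. }
  assert (HM : Rabs (circulation a t) <= 2 * PI * (gam t * y)).
  { apply (circulation_bound l a Ha); [lra|]. intros th.
    set (p := on_circle t th).
    assert (Hr : radius p = t) by (unfold p; rewrite radius_on_circle, Rabs_pos_eq; lra).
    assert (Hdp : disc l p) by (unfold disc; rewrite Hr; lra).
    assert (Hlin := proj1 Ha p Hdp).
    assert (Hw : Rabs (a p (scal (/ gam t) ((- snd p, fst p) : E2))) <= covector_norm l gam true p (a p)).
    (* The test vector is the unit tangent of the parallel, on which the form has value density /
       gam. *)
    { apply covector_norm_ge; [easy|rewrite Hr; lra|simpl; now rewrite Hr|].
      unfold metric. destruct (Req_EM_T (radius p) 0); [lra|].
      unfold lat; rewrite Hr.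
      set (w := scal (/ gam t) ((- snd p, fst p) : E2)).
      assert (W1 : dt p w = 0).
      { unfold dt. change (fst w) with (/ gam t * - snd p). change (snd w) with (/ gam t * fst p).
        unfold Rdiv; ring. }
      assert (W2 : dtheta p w = / gam t).
      { unfold dtheta. change (fst w) with (/ gam t * - snd p). change (snd w) with (/ gam t * fst p).
        transitivity (/ gam t * (fst p ^ 2 + snd p ^ 2) / radius p ^ 2); [unfold Rdiv; ring|].
        rewrite <- radius_sqr; field; lra. }
      rewrite W1, W2; right; field; lra. }
    destruct Hlin as [_ Hscal _]; rewrite Hscal in Hw.
    assert (Hy : covector_norm l gam true p (a p) <= y).
    { change (Rbar_le (covector_norm l gam true p (a p)) (Finite y)). rewrite <- Hn.
      apply Lub_Rbar_correct; now exists true, p. }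
    replace (circulation_density a t th) with (a p (- snd p, fst p)).
    - change (Rabs (/ gam t * a p (- snd p, fst p)) <= covector_norm l gam true p (a p)) in Hw.
      rewrite Rabs_mult, (Rabs_pos_eq (/ gam t)) in Hw by (apply Rlt_le, Rinv_0_lt_compat, Hg).
      apply (Rmult_le_reg_l (/ gam t)); [now apply Rinv_0_lt_compat|].
      replace (/ gam t * (gam t * y)) with y by (field; lra). lra.
    - rewrite (one_form_components l a Ha) by easy.
      unfold circulation_density, p, on_circle; simpl; ring. }
  rewrite HI, Rabs_mult, (Rabs_pos_eq (2 * PI)) in HM by (pose proof PI_RGT_0; lra).
  apply Rmult_le_reg_l in HM; [|pose proof PI_RGT_0; lra].
  apply (Rmult_le_reg_l (gam t)); [easy|]. field_simplify; lra.
Qed.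

End LowerBound.

(** * Spindles *)

Lemma smooth_sin_cos : smooth sin /\ smooth cos.
Proof.
  assert (H : forall n, Ck n (fun _ : R => True) sin /\ Ck n (fun _ : R => True) cos).
  { induction n as [|n [Hs Hc]]; split.
    - split; [intros; apply continuous_sin|easy].
    - split; [intros; apply continuous_cos|easy].
    - apply (Ck_R_S n sin cos); [apply is_derive_sin|easy].
    - apply (Ck_R_S n cos (fun x => -1 * sin x)).
      + intros t; replace (-1 * sin t) with (- sin t) by ring; apply is_derive_cos.
      + apply Ck_mult; [apply Ck_const|easy]. }
  split; intros n; apply H.
Qed.

Lemma smooth_inv_1_sqr : smooth (fun x : R => / (1 + x ^ 2)).
Proof.
  assert (D : forall x, is_derive (fun x => / (1 + x ^ 2)) x
    (-2 * x * (/ (1 + x ^ 2) * / (1 + x ^ 2)))).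
  { intros x; assert (0 < 1 + x ^ 2) by nra.
    auto_derive; [nra|field; nra]. }
  intros n; induction n as [|n IH].
  - split; [|easy]; intros t _.
    apply (ex_derive_continuous (V := R_NormedModule)); eexists; apply D.
  - apply (Ck_R_S n _ _ D).
    apply Ck_mult; apply Ck_mult; auto; [apply Ck_const|apply smooth_R_id].
Qed.

Lemma is_derive_atan_inv x : is_derive atan x (/ (1 + x ^ 2)).
Proof. replace (x ^ 2) with (x²) by (unfold Rsqr; ring). apply is_derive_atan. Qed.

Lemma smooth_atan : smooth atan.
Proof. apply (smooth_R_intro _ _ is_derive_atan_inv smooth_inv_1_sqr). Qed.

Lemma atan_bounds x : 0 <= x -> 0 <= atan x <= x.
Proof.
  intros Hx; destruct (mean_value atan _ 0 x is_derive_atan_inv Hx) as [c [Hc E]].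
  rewrite atan_0, !Rminus_0_r in E.
  assert (H : 0 < / (1 + c ^ 2) <= 1).
  { split; [apply Rinv_0_lt_compat; nra|]. rewrite <- Rinv_1. apply Rinv_le_contravar; nra. }
  rewrite E; nra.
Qed.

Lemma Derive_n_odd_about (f : R -> R) c k :
  smooth f -> (forall t, f (2 * c - t) = - f t) -> Derive_n f (2 * k) c = 0.
Proof.
  intros Hf Ho; pose proof (Derive_n_reflect f (2 * c) (2 * k) c Hf) as E.
  rewrite (Derive_n_ext _ (fun t => - f t)), Derive_n_opp, pow_1_even in E by auto.
  replace (2 * c - c) with c in E by ring. lra.
Qed.

Section Spindle.
Variables N w : R.
Hypothesis HN : 32 <= N.
Hypothesis Hw : 0 < w.

(* A spindle with cone-like ends: within distance about 1/N of the poles the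
   slope drops from 1 to about 1/2. *)
Definition spindle (u : R) : R := (sin u + atan (N * sin u) / N) / 2.

Let rho (u : R) : R := / (1 + (N * sin u) ^ 2).
(** This is - spindle'' / sin u; its positivity is the convexity of the surface. *)
Let bend (u : R) : R := (1 + rho u) / 2 + N ^ 2 * cos u ^ 2 * rho u ^ 2.

Lemma rho_bounds u : 0 < rho u <= 1.
Proof.
  unfold rho; split; [apply Rinv_0_lt_compat; nra|].
  rewrite <- Rinv_1; apply Rinv_le_contravar; nra.
Qed.

Lemma bend_pos u : 0 < bend u.
Proof.
  unfold bend; pose proof (rho_bounds u).
  assert (0 <= N ^ 2 * cos u ^ 2 * rho u ^ 2); [|lra].
  apply Rmult_le_pos; [apply Rmult_le_pos|]; apply pow2_ge_0.
Qed.

Lemma d_spindle u : is_derive spindle u (cos u * ((1 + rho u) / 2)).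
Proof.
  unfold spindle, rho; assert (0 < 1 + (N * sin u) ^ 2) by nra.
  auto_derive; [easy|]. unfold Rsqr; field. split; nra.
Qed.

Lemma d2_spindle u : is_derive (fun u => cos u * ((1 + rho u) / 2)) u (- sin u * bend u).
Proof.
  unfold bend, rho; assert (0 < 1 + (N * sin u) ^ 2) by nra.
  auto_derive; [nra|]. field; nra.
Qed.

Lemma spindle_le_sin u : 0 <= sin u -> sin u / 2 <= spindle u <= sin u.
Proof.
  intros Hs; unfold spindle.
  destruct (atan_bounds (N * sin u)) as [A1 A2]; [nra|].
  assert (0 <= atan (N * sin u) / N <= sin u); [|lra].
  split; [apply Rdiv_le_0_compat; lra|].
  apply (Rmult_le_reg_r N); [lra|]. field_simplify; lra.
Qed.

(** Scaling length and height by 1 / w preserves slopes and divides the integral by w^2; [Harea]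
    chooses w so that the integral becomes 2. *)
Definition lemon (t : R) : R := spindle (w * t) / w.

Lemma smooth_spindle : smooth spindle.
Proof.
  unfold spindle, Rdiv. pose proof (proj1 smooth_sin_cos) as Ss.
  apply smooth_mult; [|apply smooth_const]. apply smooth_plus; [easy|].
  apply smooth_mult; [|apply smooth_const].
  apply (smooth_comp R_NormedModule atan (fun u => N * sin u)); [apply smooth_atan|].
  apply smooth_mult; [apply smooth_const|easy].
Qed.

Lemma smooth_lemon : smooth lemon.
Proof.
  unfold lemon, Rdiv. apply smooth_mult; [|apply smooth_const].
  apply (smooth_comp R_NormedModule spindle (fun t => w * t)); [apply smooth_spindle|].
  apply smooth_mult; [apply smooth_const|apply smooth_R_id].
Qed.

Lemma is_derive_scaled (f : R -> R) t d : is_derive f (w * t) d -> is_derive (fun t => f (w * t)) t (w * d).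
Proof.
  intros H. apply (is_derive_comp (V := R_NormedModule) f (fun t => w * t)); [exact H|].
  auto_derive; [easy|ring].
Qed.

Lemma Derive_lemon t : Derive lemon t = cos (w * t) * ((1 + rho (w * t)) / 2).
Proof.
  apply is_derive_unique, (is_derive_ext (fun t => / w * spindle (w * t))).
  { intros s; apply Rmult_comm. }
  evar_last; [apply is_derive_scal, is_derive_scaled, d_spindle|].
  field; lra.
Qed.

Lemma Derive2_lemon t : Derive_n lemon 2 t = - w * sin (w * t) * bend (w * t).
Proof.
  change (Derive (Derive lemon) t = - w * sin (w * t) * bend (w * t)).
  rewrite (Derive_ext _ _ t Derive_lemon). apply is_derive_unique.
  evar_last; [apply (is_derive_scaled (fun u => cos u * ((1 + rho u) / 2))), d2_spindle|ring].
Qed.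

(** Gives the curvature at the poles: the derivative of [bend] is multiplied by sin, which vanishes
    there. *)
Lemma Derive3_lemon t : sin (w * t) = 0 -> Derive_n lemon 3 t = - w ^ 2 * cos (w * t) * bend (w * t).
Proof.
  intros H0.
  change (Derive (Derive_n lemon 2) t = - w ^ 2 * cos (w * t) * bend (w * t)).
  rewrite (Derive_ext _ _ t Derive2_lemon). apply is_derive_unique.
  assert (D : ex_derive (fun t => bend (w * t)) t).
  { assert (0 < 1 + (N * sin (w * t)) ^ 2) by nra.
    unfold bend, rho; auto_derive; repeat split; nra. }
  destruct D as [d D].
  set (b := fun t => bend (w * t)) in D |- *.
  change (is_derive b t d) in D.
  change (is_derive (fun t => - w * sin (w * t) * b t) t (- w ^ 2 * cos (w * t) * b t)).
  clearbody b. auto_derive; [eexists; exact D|].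
  rewrite H0; ring.
Qed.

Lemma w_length : w * (PI / w) = PI.
Proof. field; lra. Qed.

Lemma w_range t : 0 < t < PI / w -> 0 < w * t < PI.
Proof.
  intros Ht; split; [nra|]. apply (Rlt_le_trans _ (w * (PI / w))); [apply Rmult_lt_compat_l; lra|rewrite w_length; lra].
Qed.

Hypothesis Harea : is_RInt spindle 0 PI (2 * w ^ 2).

Lemma lemon_pos t : 0 < t < PI / w -> 0 < lemon t.
Proof.
  intros Ht; apply Rdiv_lt_0_compat; [|easy].
  assert (0 < sin (w * t)) by (apply sin_gt_0; now apply w_range).
  pose proof (spindle_le_sin (w * t)). lra.
Qed.

Lemma lemon_profile : normalised_profile (PI / w) lemon.
Proof.
  pose proof PI_RGT_0 as HPI.
  assert (R0 : rho 0 = 1) by (unfold rho; rewrite sin_0, Rmult_0_r, pow_ne_zero, Rplus_0_r, Rinv_1; easy).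
  assert (RP : rho PI = 1) by (unfold rho; rewrite sin_PI, Rmult_0_r, pow_ne_zero, Rplus_0_r, Rinv_1; easy).
  split.
  - apply Rdiv_lt_0_compat; lra.
  - intros; apply smooth_ex_derive_n, smooth_lemon.
  - unfold lemon, spindle; rewrite Rmult_0_r, sin_0, Rmult_0_r, atan_0; field; lra.
  - unfold lemon, spindle; rewrite w_length, sin_PI, Rmult_0_r, atan_0; field; lra.
  - exact lemon_pos.
  - rewrite Derive_lemon, Rmult_0_r, cos_0, R0; field.
  - rewrite Derive_lemon, w_length, cos_PI, RP; field.
  - intros t Ht; rewrite Derive_lemon.
    assert (0 < sin (w * t)) by (apply sin_gt_0; now apply w_range).
    pose proof (rho_bounds (w * t)). pose proof (sin2_cos2 (w * t)) as E; unfold Rsqr in E.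
    assert (Rabs (cos (w * t)) < 1) by (apply Rabs_lt_between; split; nra).
    rewrite Rabs_mult, (Rabs_pos_eq ((1 + _) / 2)) by lra.
    pose proof (Rabs_pos (cos (w * t))). nra.
  - intros k; split; apply Derive_n_odd_about; try apply smooth_lemon; intros t; unfold lemon, spindle.
    + replace (w * (2 * 0 - t)) with (- (w * t)) by ring.
      rewrite sin_neg. replace (N * - sin (w * t)) with (- (N * sin (w * t))) by ring.
      rewrite atan_opp; field; lra.
    + replace (w * (2 * (PI / w) - t)) with (- (w * t) + 2 * PI) by (field; lra).
      rewrite sin_plus, cos_2PI, sin_2PI, sin_neg.
      replace (N * (- sin (w * t) * 1 + cos (- (w * t)) * 0)) with (- (N * sin (w * t))) by ring.
      rewrite atan_opp; field; lra.
  - pose proof (is_RInt_comp_lin (V := R_NormedModule) spindle w 0 0 (PI / w) (2 * w ^ 2)) as H.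
    rewrite w_length, Rmult_0_r, !Rplus_0_r in H. specialize (H Harea).
    apply (is_RInt_scal (V := R_NormedModule) _ _ _ (/ w ^ 2)) in H.
    evar_last; [eapply is_RInt_ext; [|exact H]|].
    + intros x _; unfold lemon, scal; simpl; unfold mult; simpl. rewrite Rplus_0_r.
      generalize (spindle (w * x)); intros y. change (/ (w * (w * 1)) * (w * y) = y / w). field; lra.
    + unfold scal; simpl; unfold mult; simpl. change (/ (w * (w * 1)) * (2 * (w * (w * 1))) = 2). field; lra.
Qed.

Lemma lemon_convex t : 0 <= t <= PI / w -> 0 <= curvature lemon t.
Proof.
  intros Ht; pose proof PI_RGT_0; unfold curvature.
  destruct (Req_EM_T (lemon t) 0) as [Hz|Hz].
  - assert (Ht' : t = 0 \/ t = PI / w).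
    { destruct (Req_dec t 0); [now left|]. destruct (Req_dec t (PI / w)); [now right|].
      pose proof (lemon_pos t). lra. }
    pose proof (np_dleft _ _ lemon_profile) as D0. pose proof (np_dright _ _ lemon_profile) as Dl.
    destruct Ht' as [-> | ->].
    + rewrite D0, Derive3_lemon by (rewrite Rmult_0_r; apply sin_0).
      rewrite Rmult_0_r, cos_0. pose proof (bend_pos 0).
      replace (- (- w ^ 2 * 1 * bend 0) / 1) with (w ^ 2 * bend 0) by field. nra.
    + rewrite Dl, Derive3_lemon by (rewrite w_length; apply sin_PI).
      rewrite w_length, cos_PI. pose proof (bend_pos PI).
      replace (- (- w ^ 2 * -1 * bend PI) / -1) with (w ^ 2 * bend PI) by field. nra.
  - assert (0 <= lemon t) by (now apply (gam_nonneg _ _ lemon_profile)).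
    rewrite Derive2_lemon. pose proof (bend_pos (w * t)).
    assert (0 <= sin (w * t)).
    { apply sin_ge_0; [nra|]. rewrite <- w_length. apply Rmult_le_compat_l; lra. }
    apply Rdiv_le_0_compat; [|lra].
    assert (0 <= sin (w * t) * bend (w * t)) by nra. nra.
Qed.

Hypothesis Hw2 : 1 / 2 <= w ^ 2.

(** From w >= 7/10 and u <= pi/2 <= 2 one gets t <= 3 and gam <= 3/(2N) on [0, t], so int gam <=
    9/(2N) <= 9/64. With slope at most 3/4 this gives B <= 9/64 - 1/4 < -1/10, and the quotient is
    at least (1/10) / (3/(2N)) = N/15. *)
Lemma lemon_large : exists t, 0 < t < PI / w /\ N / 15 <= Rabs (primitive_coeff lemon t) / lemon t.
Proof.
  pose proof PI_RGT_0. pose proof PI_4 as HPI4.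
  assert (Hw7 : 7 / 10 <= w) by nra.
  (* At sin u = 1/N the value of [rho] is 1/2, so the slope is (3/4) cos u. *)
  set (u := asin (/ N)).
  assert (HiN : 0 < / N <= / 32) by (split; [apply Rinv_0_lt_compat|apply Rinv_le_contravar]; lra).
  assert (Hs : sin u = / N) by (apply sin_asin; lra).
  pose proof (asin_bound (/ N)) as Hu; fold u in Hu.
  assert (Hu0 : 0 < u).
  { destruct (Rle_or_lt u 0) as [Hle|]; [|easy].
    pose proof (sin_incr_1 u 0). rewrite sin_0 in *. lra. }
  set (t := u / w).
  assert (Ewt : w * t = u) by (unfold t; field; lra).
  assert (Ht : 0 < t <= 3).
  { split; [apply Rdiv_lt_0_compat; lra|]. apply (Rmult_le_reg_l w); [easy|]. rewrite Ewt; lra. }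
  assert (Htl : t < PI / w) by (apply (Rmult_lt_reg_l w); [easy|]; rewrite Ewt, w_length; lra).
  exists t; split; [lra|].
  assert (Hle : forall s, 0 <= s <= t -> lemon s <= 3 / 2 * / N).
  { intros s Hs'. assert (Hws : 0 <= w * s <= u) by (rewrite <- Ewt; nra).
    assert (S1 : sin (w * s) <= sin u) by (apply sin_incr_1; lra).
    assert (S0 : 0 <= sin (w * s)) by (apply sin_ge_0; lra).
    pose proof (spindle_le_sin _ S0). unfold lemon.
    apply (Rmult_le_reg_r w); [easy|]. unfold Rdiv at 1; rewrite Rmult_assoc, Rinv_l, Rmult_1_r by lra.
    rewrite Hs in S1. nra. }
  assert (HG : RInt lemon 0 t <= 9 / 2 * / N).
  { destruct (mean_value _ _ 0 t (d_G _ _ lemon_profile)) as [c [Hc E]]; [lra|].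
    rewrite RInt_point in E.
    change (RInt lemon 0 t - 0 = lemon c * (t - 0)) in E. rewrite !Rminus_0_r in E; rewrite E.
    specialize (Hle c Hc). nra. }
  assert (HD : Derive lemon t <= 3 / 4).
  { rewrite Derive_lemon, Ewt. unfold rho; rewrite Hs, Rinv_r by lra.
    pose proof (COS_bound u). replace ((1 + / (1 + 1 ^ 2)) / 2) with (3 / 4) by field. lra. }
  assert (HB : primitive_coeff lemon t <= - / 10) by (unfold primitive_coeff; lra).
  pose proof (lemon_pos t ltac:(lra)) as Hpos. specialize (Hle t ltac:(lra)).
  rewrite Rabs_left by lra.
  apply (Rmult_le_reg_r (lemon t)); [easy|].
  unfold Rdiv at 2; rewrite Rmult_assoc, Rinv_l, Rmult_1_r by lra.
  assert (N * lemon t <= 3 / 2).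
  { apply (Rmult_le_compat_l N) in Hle; [|lra].
    replace (N * (3 / 2 * / N)) with (3 / 2) in Hle by (field; lra). easy. }
  lra.
Qed.

End Spindle.

(** Comparison with sin u / 2, of integral 1, keeps the scale w bounded below independently of N. *)
Lemma spindle_area N : 32 <= N -> exists A : R, is_RInt (spindle N) 0 PI A /\ 1 <= A.
Proof.
  intros HN; pose proof PI_RGT_0.
  assert (C : ex_RInt (spindle N) 0 PI).
  { apply (ex_RInt_continuous (V := R_CompleteNormedModule)); intros; apply smooth_continuous, smooth_spindle. }
  exists (RInt (spindle N) 0 PI); split; [now apply (RInt_correct (V := R_CompleteNormedModule))|].
  assert (I : is_RInt (fun u => sin u / 2) 0 PI 1).
  { assert (E : - cos PI / 2 - - cos 0 / 2 = 1) by (rewrite cos_PI, cos_0; field).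
    assert (D : forall x : R, is_derive (fun u : R => - cos u / 2) x (sin x / 2))
      by (intros; auto_derive; [easy|field]).
    evar_last; [|exact E].
    apply (is_RInt_derive (V := R_CompleteNormedModule) (fun u => - cos u / 2)).
    - intros x _; apply D.
    - intros; apply (smooth_continuous (fun u => sin u / 2)).
      apply smooth_mult; [apply smooth_sin_cos|apply smooth_const]. }
  apply (is_RInt_le _ _ 0 PI _ _ (Rlt_le _ _ H) I (RInt_correct (V := R_CompleteNormedModule) _ _ _ C)).
  intros x Hx; apply spindle_le_sin; [lra|]. apply sin_ge_0; lra.
Qed.

Lemma convex_large_m_gamma C : 0 < C ->
  exists l gam, normalised_profile l gam /\
    (forall t, 0 <= t <= l -> 0 <= curvature gam t) /\ Rbar_lt C (m_gamma l gam).
Proof.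
  (* Ensures both N >= 32 and N / 15 > C. *)
  intros HC; set (N := 32 + 32 * C); assert (HN : 32 <= N) by (unfold N; lra).
  destruct (spindle_area N HN) as [A [HA HA1]].
  set (w := sqrt (A / 2)).
  assert (Hw2 : w ^ 2 = A / 2) by (apply pow2_sqrt; lra).
  assert (Hw : 0 < w) by (apply sqrt_lt_R0; lra).
  assert (Harea : is_RInt (spindle N) 0 PI (2 * w ^ 2))
    by (rewrite Hw2; now replace (2 * (A / 2)) with A by field).
  pose proof (lemon_profile N w HN Hw Harea) as Hp.
  exists (PI / w), (lemon N w); split; [easy|split].
  - now apply lemon_convex.
  - destruct (lemon_large N w HN Hw Harea) as [t [Ht Hlarge]]; [lra|].
    eapply Rbar_lt_le_trans; [|apply (m_gamma_ge _ _ Hp t Ht)].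
    simpl; unfold N in *; lra.
Qed.

Theorem proposition4 :
  (forall (l : R) (gam : R -> R),
     normalised_profile l gam ->
     (forall t, 0 <= t <= l -> gam t = gam (l - t)) ->
     (forall s t, 0 <= s -> s <= t -> t <= l / 2 ->
        curvature gam s <= curvature gam t) ->
     Rbar_le (m_gamma l gam) (Finite 1) /\
     (forall m : R, Con l gam m <-> 0 <= m))
  /\
  (forall C : R, 0 < C ->
     exists (l : R) (gam : R -> R),
       normalised_profile l gam /\
       (forall t, 0 <= t <= l -> 0 <= curvature gam t) /\
       Rbar_lt (Finite C) (m_gamma l gam)).
Proof.
  split; [|exact convex_large_m_gamma].
  intros l gam Hp sym mono.
  pose proof (primitive_coeff_bound l gam Hp sym mono) as bound.
  destruct (chart_data_profile l gam Hp true) as [D1 _].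
  destruct (chart_data_profile l gam Hp false) as [D2 _].
  (* The data of the two charts are obtained separately, from existence statements, and joined by a
     dependent match. *)
  pose (D := fun b : bool => if b return chart_data (chart_profile l gam b) then D1 else D2).
  split; [exact (m_gamma_le_1 l gam Hp D bound)|].
  intros m; split.
  - intros [->|[Hm _]]; lra.
  - intros [Hm|<-]; [right|now left].
    split; [lra|]; now apply (contact_type l gam Hp D bound).
Qed.
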